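(* Let $r\geq 1$ and $n\geq 3$ be integers, let $X_{r,n}:=\mathrm{Hom}(C_{2r+1},K_n)$, and let $\mathbb{Z}_2$ act on $X_{r,n}$ through the involution $\gamma$ induced by the reflection $v\mapsto -v$ of $C_{2r+1}$. Then $w_1^{n-2}(X_{r,n})=0$ in $H^{n-2}(X_{r,n}/\mathbb{Z}_2;\mathbb{Z}_2)$, where $w_1(X_{r,n})\in H^1(X_{r,n}/\mathbb{Z}_2;\mathbb{Z}_2)$ is the first Stiefel-Whitney class of this $\mathbb{Z}_2$-space and $w_1^{n-2}$ denotes its $(n-2)$-nd cup power.
   Context: Hom complexes: for finite graphs $T$ and $G$, let $\Delta^{V(G)}$ be the simplex with vertex set $V(G)$. Then $\mathrm{Hom}(T,G)$ is the subcomplex of the polyhedral complex $\prod_{x\in V(T)}\Delta^{V(G)}$ consisting of all cells $\sigma=\prod_{x\in V(T)}\sigma_x$ (each $\sigma_x$ a nonempty simplex, identified with its vertex set, a nonempty subset of $V(G)$) such that for any $x,y\in V(T)$ with $(x,y)\in E(T)$, every element of $\sigma_x$ is adjacent in $G$ to every element of $\sigma_y$. Thus cells are indexed by functions $\sigma:V(T)\to 2^{V(G)}\setminus\{\emptyset\}$ with this property, and $\dim\sigma=\sum_{v\in V(T)}(|\sigma(v)|-1)$. Graphs: $K_n$ is the complete graph (without loops) on the vertex set $[n]=\{1,\dots,n\}$. $C_{2r+1}$ is the cycle graph with $2r+1$ vertices, whose vertex set is identified with the additive cyclic group of order $2r+1$, the vertices adjacent to $v$ being $v+1$ and $v-1$.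 Involution: the map $v\mapsto -v$ is an automorphism of $C_{2r+1}$ which fixes the vertex $0$ and flips the edge $(r,r+1)$. It induces a cellular involution $\gamma$ of $X_{r,n}$, given on cells by $(\gamma\sigma)(v)=\sigma(-v)$. This defines a free $\mathbb{Z}_2$-action on $X_{r,n}$ (free because of the flipped edge). Stiefel-Whitney class: for a space $X$ with this kind of free $\mathbb{Z}_2$-action, $w_1(X)\in H^1(X/\mathbb{Z}_2;\mathbb{Z}_2)$ denotes the first Stiefel-Whitney class of the associated real line bundle $X\times_{\mathbb{Z}_2}\mathbb{R}\to X/\mathbb{Z}_2$, where $\mathbb{Z}_2$ acts on $\mathbb{R}$ by $t\mapsto -t$. *)

(* Defs.v *)
From HB Require Import structures.
From mathcomp Require Import all_boot all_order all_algebra.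
From mathcomp Require Import all_classical all_reals all_analysis.
From mathcomp Require Import zify.

Set Implicit Arguments.
Unset Strict Implicit.
Unset Printing Implicit Defensive.
Import Order.TTheory GRing.Theory Num.Theory.
Import numFieldNormedType.Exports.
Local Open Scope classical_set_scope.
Local Open Scope ring_scope.
Local Open Scope quotient_scope.

Section simplices.
Context {R : realType}.

Definition std_simplex N : set 'rV[R]_N :=
  [set x | (forall i, 0 <= x 0 i) /\ \sum_i x 0 i = 1].
Arguments std_simplex N : clear implicits.

Definition simplex k : topologicalType := set_type (std_simplex k.+1).

(* The affine map sending the i-th vertex to the (theta i)-th vertex. *)
Definition vertex_map_fun k m (theta : 'I_k.+1 -> 'I_m.+1) (x : 'rV[R]_k.+1) :
    'rV[R]_m.+1 :=
  \row_j \sum_(i | theta i == j) x 0 i.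

Lemma vertex_map_subproof k m (theta : 'I_k.+1 -> 'I_m.+1) (x : simplex k) :
  vertex_map_fun theta (val x) \in std_simplex m.+1.
Proof.
case: x => x /= /set_mem[x0 x1]; apply/mem_set; split=> [j|].
  by rewrite mxE; apply: sumr_ge0.
rewrite -x1 (partition_big theta xpredT)//=.
by apply: eq_bigr => j _; rewrite mxE; apply: eq_bigl.
Qed.

Definition vertex_map k m (theta : 'I_k.+1 -> 'I_m.+1) (x : simplex k) :
    simplex m :=
  exist _ (vertex_map_fun theta (val x)) (vertex_map_subproof theta x).

Lemma mx_continuous (T : topologicalType) m n (f : T -> 'M[R]_(m, n)) :
  (forall i j, continuous (fun x => f x i j)) -> continuous f.
Proof.
move=> fc x U [P nP sPU].
have : \forall y \near x, forall i j, P i j (f y i j).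
  do 2![apply: filter_forall => ?]; apply: fc; exact: nP.
by apply: filterS => y Py; exact: sPU.
Qed.

Lemma set_type_continuous (T X : topologicalType) (A : set X) (f : T -> A) :
  continuous (val \o f) -> continuous f.
Proof. by move=> fc; apply: continuous_comp_initial. Qed.

Lemma set_val_continuous (X : topologicalType) (A : set X) :
  continuous (val : A -> X).
Proof. exact: initial_continuous. Qed.

Lemma vertex_map_continuous k m (theta : 'I_k.+1 -> 'I_m.+1) :
  continuous (vertex_map theta).
Proof.
apply: set_type_continuous; apply: mx_continuous => i j.
rewrite (_ : (fun _ => _) =
    fun x : simplex k => \sum_(l | theta l == j) val x 0 l); last first.
  by apply/funext => x /=; rewrite mxE.
apply: (@continuous_big R _ +%R 0 (fun l => theta l == j) (@add_continuous R^o)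
  (simplex k) (index_enum _) (fun l (x : simplex k) => val x 0 l)).
move=> l _ x; apply: (@continuous_comp _ _ _ (val : simplex k -> 'rV[R]_k.+1)
    (fun y : 'rV[R]_k.+1 => y 0 l)); first exact: set_val_continuous.
exact: coord_continuous.
Qed.

HB.instance Definition _ k m (theta : 'I_k.+1 -> 'I_m.+1) :=
  isContinuous.Build _ _ (vertex_map theta) (@vertex_map_continuous k m theta).

Lemma vertex_map_comp k m p (theta : 'I_k.+1 -> 'I_m.+1)
    (eta : 'I_m.+1 -> 'I_p.+1) :
  vertex_map eta \o vertex_map theta = vertex_map (eta \o theta).
Proof.
apply/funext => x; apply/val_inj => /=; apply/rowP => j; rewrite !mxE.
under eq_bigr do rewrite mxE.
rewrite [RHS](partition_big theta (fun i => eta i == j))//=.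
apply: eq_bigr => i /eqP ij; apply: eq_bigl => l.
by apply/eqP/andP => [->|[_ /eqP//]]; rewrite ij !eqxx.
Qed.

End simplices.
Arguments simplex R k : clear implicits.
Arguments std_simplex R N : clear implicits.

Lemma addFF2 (x : 'F_2) : x + x = 0.
Proof. by rewrite -mulr2n -mulr_natl (pchar_Zp (isT : (1 < 2)%N)) mul0r. Qed.

Section cohomology.
Context {R : realType} {X : topologicalType}.

Definition singular k := continuousType (simplex R k) X.

Definition restr k m (theta : 'I_k.+1 -> 'I_m.+1) (s : singular m) :
  singular k := s \o vertex_map theta.

Lemma restr_comp k m p (theta : 'I_k.+1 -> 'I_m.+1) (eta : 'I_m.+1 -> 'I_p.+1)
    (s : singular p) :
  restr theta (restr eta s) = restr (eta \o theta) s.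
Proof.
apply/continuousEP => x.
exact: (congr1 s (congr1 (@^~ x) (vertex_map_comp theta eta))).
Qed.

Definition cochain k := singular k -> 'F_2.
HB.instance Definition _ k := GRing.Zmodule.on (cochain k).

(* No signs are needed modulo 2. *)
Definition coboundary k (f : cochain k) : cochain k.+1 :=
  fun s => \sum_(i < k.+2) f (restr (lift i) s).

Lemma coboundary_is_zmod_morphism k : zmod_morphism (@coboundary k).
Proof.
by move=> f g; apply/funext => s; rewrite /coboundary !fctE -sumrB.
Qed.

HB.instance Definition _ k :=
  GRing.isZmodMorphism.Build _ _ (@coboundary k) (@coboundary_is_zmod_morphism k).

Definition cocycle k : {pred cochain k} := [pred f | `[< coboundary f = 0 >]].

Lemma cocycle_zmod_closed k : zmod_closed (@cocycle k).
Proof.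
split=> [|f g]; first by apply/asboolP; rewrite raddf0.
by move=> /asboolP f0 /asboolP g0; apply/asboolP; rewrite raddfB /= f0 g0 subr0.
Qed.

HB.instance Definition _ k :=
  GRing.isZmodClosed.Build _ (@cocycle k) (@cocycle_zmod_closed k).

Definition cocycles k := {f : cochain k | f \in @cocycle k}.
HB.instance Definition _ k := SubChoice.on (cocycles k).
HB.instance Definition _ k := [SubChoice_isSubZmodule of cocycles k by <:].

Definition is_coboundary k : cochain k -> Prop :=
  match k with
  | 0 => fun f => f = 0
  | k.+1 => fun f => exists g : cochain k, f = coboundary g
  end.

Definition coboundaries k : {pred cocycles k} :=
  [pred f | `[< is_coboundary (val f) >]].

Lemma coboundaries_zmod_closed k : zmod_closed (@coboundaries k).
Proof.
case: k => [|k]; split=> [|f g].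
- by apply/asboolP.
- move=> /asboolP/= f0 /asboolP/= g0.
  by apply/asboolP; rewrite /= f0 g0 subr0.
- by apply/asboolP; exists 0; rewrite !raddf0.
move=> /asboolP/=[f' ff'] /asboolP/=[g' gg']; apply/asboolP.
by exists (f' - g'); rewrite raddfB /= ff' gg' -raddfB.
Qed.

HB.instance Definition _ k :=
  GRing.isZmodClosed.Build _ (@coboundaries k) (@coboundaries_zmod_closed k).

Definition cohomology k := Quotient.quot (@coboundaries k).
HB.instance Definition _ k := GRing.Zmodule.on (cohomology k).

Definition coh_class k (f : cocycles k) : cohomology k := \pi f.

(* The face of the standard N-simplex spanned by the vertices a, ..., a + p. *)
Definition segment N a p (i : 'I_p.+1) : 'I_N.+1 := inord (a + i).

Definition cup_cochain N k l (f : cochain k) (g : cochain l) : cochain N :=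
  fun s => f (restr (@segment N 0 k) s) * g (restr (@segment N k l) s).
Arguments cup_cochain N [k l] f g.

Lemma val_segment N a p (i : 'I_p.+1) : (a + p <= N)%N ->
  segment N a i = (a + i)%N :> nat.
Proof.
move=> apN; rewrite inordK// ltnS (leq_trans _ apN)// leq_add2l.
by rewrite -ltnS.
Qed.

Lemma coboundary_cup_cochain k l (f : cochain k) (g : cochain l) :
  coboundary (cup_cochain (k + l) f g) =
  cup_cochain (k + l).+1 (coboundary f) g +
  cup_cochain (k + l).+1 f (coboundary g).
Proof.
apply/funext => s; rewrite !fctE /coboundary /cup_cochain.
rewrite mulr_suml mulr_sumr.
under eq_bigr do rewrite !restr_comp.
under [X in _ = X + _]eq_bigr do rewrite !restr_comp.
under [X in _ = _ + X]eq_bigr do rewrite !restr_comp.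
pose P i := f (restr (@segment (k + l).+1 0 k.+1 \o lift (inord i)) s) *
            g (restr (@segment (k + l).+1 k.+1 l) s).
pose Q i := f (restr (@segment (k + l).+1 0 k) s) *
            g (restr (@segment (k + l).+1 k l.+1 \o lift (inord i)) s).
have fgE t t' u u' : t = t' -> u = u' ->
    f (restr t s) * g (restr u s) = f (restr t' s) * g (restr u' s).
  by move=> -> ->.
have vs := val_segment; have lk := leq_addr l k.
rewrite [X in _ = X + _](_ : _ = \sum_(0 <= i < k.+2) P i); last first.
  by rewrite big_mkord; apply: eq_bigr => i _; rewrite /P inord_val.
rewrite [X in _ = _ + X](_ : _ = \sum_(0 <= i < l.+2) Q i); last first.
  by rewrite big_mkord; apply: eq_bigr => i _; rewrite /Q inord_val.
rewrite [LHS](_ : _ =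
    \sum_(0 <= i < (k + l).+2) if (i <= k)%N then P i else Q (i - k)%N);
    last first.
  rewrite big_mkord; apply: eq_bigr => i _; rewrite /P /Q.
  have iN := ltn_ord i.
  case: leqP => ik; apply: fgE;
    apply/funext => j; apply/val_inj; have := ltn_ord j => jlt /=;
    rewrite ?vs /= ?inordK ?vs /bump /=; lia.
rewrite (@big_cat_nat _ _ _ k.+1)//=; last by lia.
rewrite [in RHS]big_nat_recr//= [X in _ = _ + X]big_nat_recl//=.
have -> : Q 0%N = P k.+1.
  rewrite /P /Q; apply: fgE;
    apply/funext => j; apply/val_inj; have := ltn_ord j => jlt /=;
    rewrite ?vs /= ?inordK ?vs /bump /=; lia.
rewrite [RHS]addrA -[X in _ = X + _]addrA addFF2 addr0.
congr (_ + _).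
  by apply: eq_big_nat => i /andP[_]; rewrite ltnS => ->.
rewrite -{1}[k.+1]add0n big_addn.
have -> : ((k + l).+2 - k.+1 = l.+1)%N by lia.
apply: eq_bigr => i _; rewrite ifF; last by lia.
by congr Q; lia.
Qed.

Lemma cup_cochain_cocycle k l (f : cocycles k) (g : cocycles l) :
  cup_cochain (k + l) (val f) (val g) \in @cocycle (k + l).
Proof.
case: f g => [f /= /asboolP f0] [g /= /asboolP g0]; apply/asboolP.
rewrite coboundary_cup_cochain f0 g0; apply/funext => s.
by rewrite !fctE /cup_cochain mul0r mulr0 addr0.
Qed.

Definition cup_cocycle k l (f : cocycles k) (g : cocycles l) : cocycles (k + l) :=
  exist _ (cup_cochain (k + l) (val f) (val g)) (cup_cochain_cocycle f g).

Definition cup k l (a : cohomology k) (b : cohomology l) : cohomology (k + l) :=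
  coh_class (cup_cocycle (repr a) (repr b)).

Lemma coh_classP k (f g : cocycles k) :
  reflect (is_coboundary (val f - val g)) (coh_class f == coh_class g).
Proof. by rewrite -Quotient.idealrBE; exact: asboolP. Qed.

Lemma coh_class_reprK k (a : cohomology k) : coh_class (repr a) = a.
Proof. exact: reprK. Qed.

Lemma is_coboundaryD k (f g : cochain k) :
  is_coboundary f -> is_coboundary g -> is_coboundary (f + g).
Proof.
case: k f g => [|k] f g /=; first by move=> -> ->; rewrite addr0.
by move=> [f' ->] [g' ->]; exists (f' + g'); rewrite raddfD.
Qed.

Lemma cup_coh_class k l (f : cocycles k) (g : cocycles l) :
  cup (coh_class f) (coh_class g) = coh_class (cup_cocycle f g).
Proof.
rewrite /cup; set f' := repr (coh_class f); set g' := repr (coh_class g).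
have /eqP/coh_classP := coh_class_reprK (coh_class f); rewrite -/f' => ff.
have /eqP/coh_classP := coh_class_reprK (coh_class g); rewrite -/g' => gg.
apply/eqP/coh_classP => /=.
rewrite (_ : _ - _ = cup_cochain (k + l) (val f' - val f) (val g') +
    cup_cochain (k + l) (val f) (val g' - val g)); last first.
  by apply/funext => s; rewrite !fctE /cup_cochain mulrBl mulrBr addrA subrK.
case: f f' ff => [f /= /asboolP f0] [f' /= _].
case: g g' gg => [g /= _] [g' /= /asboolP g'0] gg ff.
apply: is_coboundaryD.
  case: k f f0 f' ff => [|k] f f0 f' /=.
    move=> ->; case: l {g gg} g' g'0 => [|l] g' g'0 /=; last exists 0;
      apply/funext => s; by rewrite ?raddf0 /cup_cochain mul0r.
  move=> [h ->]; exists (cup_cochain (k + l) h g').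
  rewrite coboundary_cup_cochain g'0; apply/funext => s.
  by rewrite !fctE /cup_cochain mulr0 addr0.
case: l g g' g'0 gg => [|l] g g' _ /=.
  move=> ->; rewrite addn0; case: k f {f0 f' ff} => [|k] f /=;
    last exists 0; apply/funext => s; by rewrite ?raddf0 /cup_cochain mulr0.
move=> [h ->]; rewrite addnS; exists (cup_cochain (k + l) f h).
rewrite coboundary_cup_cochain f0; apply/funext => s.
by rewrite !fctE /cup_cochain mul0r add0r.
Qed.

Lemma one_cochain_cocycle : (fun=> 1 : 'F_2) \in @cocycle 0.
Proof.
apply/asboolP/funext => s; rewrite /coboundary big_ord_recl big_ord1.
exact: addFF2.
Qed.

Definition cup_one : cohomology 0 := coh_class (exist _ (fun=> 1) one_cochain_cocycle).

Fixpoint cup_power (a : cohomology 1) m : cohomology m :=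
  match m with
  | 0 => cup_one
  | m.+1 => cup a (cup_power a m)
  end.

End cohomology.
Arguments singular R X k : clear implicits.
Arguments cochain R X k : clear implicits.
Arguments cocycles R X k : clear implicits.
Arguments cohomology R X k : clear implicits.

Lemma pair_continuous (X Y Z : topologicalType) (f : Z -> X) (h : Z -> Y) :
  continuous f -> continuous h -> continuous (fun z => (f z, h z)).
Proof. by move=> fc hc z; apply: (cvg_pair (fc z) (hc z)). Qed.

Section pullback.
Context {R : realType} {X Y : topologicalType} (h : continuousType X Y).

Definition pull_singular k (s : singular R X k) : singular R Y k := h \o s.

Definition pull_cochain k (c : cochain R Y k) : cochain R X k :=
  fun s => c (pull_singular s).

Lemma pull_restr k m (theta : 'I_k.+1 -> 'I_m.+1) (s : singular R X m) :
  pull_singular (restr theta s) = restr theta (pull_singular s).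
Proof. exact/continuousEP. Qed.

Lemma coboundary_pull k (c : cochain R Y k) :
  coboundary (pull_cochain c) = pull_cochain (coboundary c).
Proof.
apply/funext => s; rewrite /pull_cochain /coboundary.
by apply: eq_bigr => i _; rewrite pull_restr.
Qed.

Lemma pull_cochain_cocycle k (c : cocycles R Y k) :
  pull_cochain (val c) \in @cocycle R X k.
Proof.
case: c => c /= /asboolP c0; apply/asboolP.
by rewrite coboundary_pull c0.
Qed.

Definition pull_cocycle k (c : cocycles R Y k) : cocycles R X k :=
  exist _ (pull_cochain (val c)) (pull_cochain_cocycle c).

End pullback.

Record free_involution (X : topologicalType) := FreeInvolution {
  inv_fun :> X -> X;
  inv_continuous : continuous inv_fun;
  inv_involutive : involutive inv_fun;
  inv_free : forall x, inv_fun x <> x }.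

Section orbit_space.
Context {X : topologicalType} (g : free_involution X).

Definition orbit_rel : rel X := fun x y => (x == y) || (x == g y).

Lemma orbit_rel_equiv : equiv_class_of orbit_rel.
Proof.
have gK := inv_involutive g; rewrite /orbit_rel; split.
- by move=> x; rewrite eqxx.
- move=> x y; rewrite eq_sym; congr (_ || _).
  by apply/eqP/eqP => [->|->]; rewrite gK.
- move=> y x z /orP[]/eqP-> // /orP[]/eqP->; rewrite ?gK eqxx ?orbT//.
Qed.

Canonical orbit_equiv := EquivRelPack orbit_rel_equiv.

Definition orbit_space : topologicalType :=
  quotient_topology {eq_quot orbit_equiv}.

Definition orbit (x : X) : orbit_space := \pi x.

Lemma orbitP (x y : X) : orbit x = orbit y <-> x = y \/ x = g y.
Proof.
have xyP : reflect (orbit x = orbit y) (orbit_rel x y).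
  exact: (@eqmodP _ orbit_equiv).
split=> [/xyP/orP[]/eqP|xy]; [by left|by right|].
by apply/xyP; rewrite /orbit_rel; case: xy => ->; rewrite eqxx ?orbT.
Qed.

Lemma orbit_surj (b : orbit_space) : exists x, orbit x = b.
Proof. by exists (repr b); exact: reprK. Qed.

Lemma orbit_continuous : continuous orbit.
Proof. exact: pi_continuous. Qed.

End orbit_space.

Section line_bundle.
Context {R : realType} {X : topologicalType} (g : free_involution X).

Definition line_inv_fun (p : X * R) : X * R := (g p.1, - p.2).

Lemma line_inv_continuous : continuous line_inv_fun.
Proof.
apply: pair_continuous => p.
  apply: (@continuous_comp _ _ _ fst g); first exact: cvg_fst.
  exact: inv_continuous.
apply: (@continuous_comp _ R R snd -%R); first exact: cvg_snd.
exact: (@opp_continuous R^o).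
Qed.

Lemma line_inv_involutive : involutive line_inv_fun.
Proof. by case=> x t; rewrite /line_inv_fun /= inv_involutive opprK. Qed.

Lemma line_inv_free p : line_inv_fun p <> p.
Proof. by case: p => x t [/inv_free]. Qed.

Definition line_inv : free_involution (X * R)%type :=
  FreeInvolution line_inv_continuous line_inv_involutive line_inv_free.

(* The quotient of X x R by (x, t) ~ (g x, - t). *)
Definition line_bundle : topologicalType := orbit_space line_inv.

Definition line_proj (e : line_bundle) : orbit_space g := orbit g (repr e).1.

Lemma line_projE x t : line_proj (orbit line_inv (x, t)) = orbit g x.
Proof.
rewrite /line_proj; apply/orbitP.
have /orbitP[->|->] := reprK (orbit line_inv (x, t)); first by left.
by right.
Qed.

Definition line_fiber (b : orbit_space g) : set line_bundle :=
  line_proj @^-1` [set b].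

Definition line_nonzero : set line_bundle :=
  [set orbit line_inv p | p in [set p | p.2 != 0]].

Definition zero_section_fun (b : orbit_space g) : line_bundle :=
  orbit line_inv (repr b, 0).

Lemma zero_section_funE x :
  zero_section_fun (orbit g x) = orbit line_inv (x, 0).
Proof.
have /orbitP[xE|xE] := reprK (orbit g x); apply/orbitP; rewrite xE; first by left.
by right; rewrite /= /line_inv_fun /= oppr0.
Qed.

Lemma zero_section_continuous : continuous zero_section_fun.
Proof.
apply/quotient_continuous.
rewrite (_ : _ \o _ = orbit line_inv \o (fun x => (x, 0))); last first.
  by apply/funext => x; exact: zero_section_funE.
move=> x; apply: continuous_comp; last exact: orbit_continuous.
by apply: pair_continuous => ?; [exact: cvg_id|exact: cvg_cst].
Qed.

Definition zero_section : continuousType (orbit_space g) line_bundle :=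
  mkcts zero_section_continuous.

Definition vanishes_on (E : topologicalType) k (A : set E) (c : cochain R E k) :=
  forall s : singular R E k, range s `<=` A -> c s = 0.

(* [u] is a relative cocycle of the pair consisting of the total space and the
   complement of the zero section, and it represents a Thom class: for each
   fibre F its restriction to H^1(F, F \ 0), a group with two elements, is
   nonzero, i.e. it is not the coboundary of a relative 0-cochain. *)
Definition is_thom_cocycle (u : cocycles R line_bundle 1) :=
  vanishes_on line_nonzero (val u) /\
  forall b, ~ exists f : cochain R line_bundle 0,
    vanishes_on (line_fiber b `&` line_nonzero) f /\
    vanishes_on (line_fiber b) (val u - coboundary f).

(* The first Stiefel-Whitney class of a line bundle is its top one, i.e. the
   restriction of the Thom class to the zero section (Milnor and Stasheff,
   Characteristic classes, sections 8 and 9). *)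
Definition is_w1 (w : cohomology R (orbit_space g) 1) :=
  exists2 u, is_thom_cocycle u & w = coh_class (pull_cocycle zero_section u).

End line_bundle.
Arguments is_w1 {R X} g w.

Section hom_complex.
Context {R : realType} {m n : nat}.
Variables (eT : rel 'I_m) (eG : rel 'I_n).

Definition is_hom_cell (sigma : 'I_m -> {set 'I_n}) :=
  (forall x, sigma x != finset.set0) /\
  (forall x y, eT x y ->
    forall a b, a \in sigma x -> b \in sigma y -> eG a b).

(* A point of the product of m copies of the simplex on the vertices of G is a
   matrix, its x-th row being the component indexed by x. *)
Definition closed_cell (sigma : 'I_m -> {set 'I_n}) : set 'M[R]_(m, n) :=
  [set p | forall x, std_simplex R n (row x p) /\
                     forall a, p x a != 0 -> a \in sigma x].

Definition hom_complex : set 'M[R]_(m, n) :=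
  [set p | exists2 sigma, is_hom_cell sigma & closed_cell sigma p].

End hom_complex.
Arguments hom_complex R {m n} eT eG.

Definition complete_graph n : rel 'I_n := fun a b => a != b.

(* For r >= 1, 'Z_(r.*2.+1) is the cyclic group of order 2r+1. *)
Definition odd_cycle r : rel 'Z_(r.*2.+1) :=
  fun u v => (v == u + 1) || (v == u - 1).

Section cycle_complex.
Context {R : realType} {r n : nat}.

Definition cycle_complex_set := hom_complex R (@odd_cycle r) (@complete_graph n).

Definition cycle_complex : topologicalType := set_type cycle_complex_set.

Definition flip_mx (p : 'M[R]_((Zp_trunc r.*2.+1).+2, n)) :
    'M[R]_((Zp_trunc r.*2.+1).+2, n) :=
  \matrix_(v, a) p (- (v : 'Z_(r.*2.+1))) a.

Lemma flip_subproof (p : cycle_complex) :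
  flip_mx (val p) \in cycle_complex_set.
Proof.
case: p => p /= /set_mem[sigma [sigma0 sigmaE] psigma]; apply/mem_set.
exists (fun v : 'Z_(r.*2.+1) => sigma (- v)).
  split=> // v w /= vw; apply: sigmaE; move: vw.
  rewrite /odd_cycle => /orP[]/eqP->.
    by rewrite opprD eqxx orbT.
  by rewrite opprB addrC eqxx.
move=> v; have [pv sv] := psigma (- (v : 'Z_(r.*2.+1))); split.
  rewrite (_ : row v _ = row (- (v : 'Z_(r.*2.+1))) p)//.
  by apply/rowP => a; rewrite !mxE.
by move=> a; rewrite mxE; exact: sv.
Qed.

Definition flip_fun (p : cycle_complex) : cycle_complex :=
  exist _ (flip_mx (val p)) (flip_subproof p).

Lemma flip_continuous : continuous flip_fun.
Proof.
apply: set_type_continuous; apply: mx_continuous => v a.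
rewrite (_ : (fun _ => _) =
    (fun q : 'M[R]__ => q (- (v : 'Z_(r.*2.+1))) a) \o
    (val : cycle_complex -> 'M[R]__)); last first.
  by apply/funext => p; rewrite /= mxE.
move=> p; apply: continuous_comp; first exact: set_val_continuous.
exact: coord_continuous.
Qed.

Lemma flip_involutive : involutive flip_fun.
Proof. by move=> p; apply/val_inj/matrixP => v a; rewrite !mxE opprK. Qed.

Lemma flip_free (r_ge1 : (1 <= r)%N) (p : cycle_complex) : flip_fun p <> p.
Proof.
move=> /(congr1 val)/matrixP/= pE.
have [sigma [_ sigmaE] psigma] := set_mem (valP p).
pose v : 'Z_(r.*2.+1) := r%:R.
have vE : - v = v + 1.
  apply/esym/eqP; rewrite -addr_eq0 addrAC -natrD addnn -[1]/(1%:R) -natrD.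
  by rewrite addn1 pchar_Zp//; lia.
have [a pva] : exists a, val p v a != 0.
  apply/not_existsP => pv0; have [[_ +] _] := psigma v.
  rewrite big1 => [/eqP|a _]; first by rewrite eq_sym oner_eq0.
  by rewrite mxE; apply/eqP/negPn/negP; exact: pv0.
have av : a \in sigma v by exact: (psigma v).2.
have av' : a \in sigma (v + 1).
  by apply: (psigma (v + 1)).2; rewrite -vE; have := pE v a; rewrite mxE => ->.
have := sigmaE v (v + 1) _ a a av av'.
by rewrite /odd_cycle eqxx /complete_graph eqxx => /(_ isT).
Qed.

Definition flip (r_ge1 : (1 <= r)%N) : free_involution cycle_complex :=
  FreeInvolution flip_continuous flip_involutive (flip_free r_ge1).

End cycle_complex.
Arguments cycle_complex R r n : clear implicits.
Arguments flip R {r} n r_ge1.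

(* Main.v *)
From HB Require Import structures.
From Pilot Require Import Defs.
From mathcomp Require Import all_boot all_order all_algebra.
From mathcomp Require Import all_classical all_reals all_analysis.
From mathcomp Require Import zify ring lra.

Set Implicit Arguments.
Unset Strict Implicit.
Unset Printing Implicit Defensive.
Import Order.TTheory GRing.Theory Num.Theory.
Import numFieldNormedType.Exports.
Import Pilot.Defs.
Local Open Scope classical_set_scope.
Local Open Scope ring_scope.

(** A point p of the complex has a component p_v in the simplex on n vertices
    for each vertex v of the cycle, and adjacent vertices have components with
    disjoint supports. So if u is a convex combination of components at
    neighbours of v, then u - p_v is nonzero, and it stays nonzero, uniformly,
    in the space E of dimension n - 1 obtained by dropping the last coordinate.

    The map f(p) = (-1)^r (p_r - p_(r+1)) to E minus the origin is odd, because
    the reflection exchanges r and r + 1. Hence w_1^(n-2) is pulled back from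
    the top class of a projective space of dimension n - 2, which is the
    transfer of the fundamental class s of the sphere; so w_1^(n-2) is the
    transfer of f^* s. On the other hand, the segments from p_k - p_(k+1) to
    p_(k+2) - p_(k+1) avoid the origin, so that, walking around half of the
    cycle, f is homotopic to p_0 - p_1, and then by one more segment to
    h(p) = p_0 - (p_1 + p_(-1)) / 2. This map is invariant under the
    reflection. The transfer of a class that comes from the orbit space is
    twice that class, so the transfer of f^* s = h^* s is 0.

    This is carried out with explicit cochains that depend only on the vertices
    of a singular simplex. Three facts link them to singular cohomology. A
    cocycle that vanishes on all simplices small with respect to an open cover
    is a coboundary (small_cocycle_coboundary), so only small simplices matter,
    and these lift to the double cover (orbit_lift). A cocycle a representing
    w_1 can be written as b(x) + b(y) on a small path with lift from x to y,
    where b changes at every point under the involution (thom_pullback); any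
    other function with this property, such as the sign of a coordinate of f,
    gives a cohomologous cocycle. If the j-th factor of w_1^(n-2) is represented
    by means of the sign of the j-th coordinate, then the product is supported
    near the points where only the last coordinate of f is away from 0. There
    it is the sum of its restrictions to the two half-axes, i.e. of f^* s and
    its image under the involution, where s is axis_cochain. A discrete prism
    operator (prismP) makes f^* s and h^* s differ by the coboundary of a
    cochain e, and then the sum of e and its image under the involution descends
    to a cochain with coboundary w_1^(n-2) on small simplices
    (cup_power_w1_eq0). *)

(** * Coboundaries and barycentric subdivision on lists of vertices *)

Lemma addF2K (x y : 'F_2) : x + (x + y) = y.
Proof. by rewrite addrA addFF2 add0r. Qed.

Lemma oppF2 (x : 'F_2) : - x = x.
Proof. by apply/eqP; rewrite eq_sym -addr_eq0 addFF2. Qed.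

Lemma addF2_eq0 (x y : 'F_2) : x + y = 0 -> x = y.
Proof. by move/eqP; rewrite addr_eq0 oppF2 => /eqP. Qed.

Lemma F2_case (x : 'F_2) : x = 0 \/ x = 1.
Proof.
case: x => -[|[|m]] i; first by left; apply: ord_inj.
  by right; apply: ord_inj.
by have : (m.+2 < 2)%N := i.
Qed.

Section list_cochains.
Context {T : Type}.
Implicit Types (g h : seq T -> 'F_2) (s : seq T).

Fixpoint delete i s :=
  if s is x :: s' then if i is i'.+1 then x :: delete i' s' else s' else [::].

Lemma size_delete i s : (i < size s)%N -> size (delete i s) = (size s).-1.
Proof.
elim: s i => [|x s IH] [|i]//=; rewrite ltnS => si.
by rewrite IH// prednK// (leq_ltn_trans _ si).
Qed.

Lemma nth_delete x0 i s j : nth x0 (delete i s) j = nth x0 s (bump i j).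
Proof.
elim: s i j => [|x s IH] [|i] [|j]; rewrite ?nth_nil//= IH /bump ltnS.
by rewrite addnS.
Qed.

(** The coboundary of a cochain g on ordered simplices. The recursion splits
    off the face opposite to the first vertex; the other faces are cones from
    that vertex. So identities about cones follow by induction, with no
    arithmetic on indices. The empty list is a simplex of dimension -1. *)
Fixpoint face_sum g s : 'F_2 :=
  if s is x :: s' then g s' + face_sum (g \o cons x) s' else 0.

Lemma face_sumE g s : face_sum g s = \sum_(i < size s) g (delete i s).
Proof.
elim: s g => [|x s IH] g /=; first by rewrite big_ord0.
by rewrite big_ord_recl IH.
Qed.

Lemma face_sum_cons g x s :
  face_sum g (x :: s) = g s + face_sum (g \o cons x) s.
Proof. by []. Qed.

Lemma face_sumD g h s :
  face_sum (fun t => g t + h t) s = face_sum g s + face_sum h s.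
Proof. by rewrite !face_sumE big_split. Qed.

Lemma face_sumZ (c : 'F_2) g s :
  face_sum (fun t => c * g t) s = c * face_sum g s.
Proof. by rewrite !face_sumE mulr_sumr. Qed.

Lemma face_sumK g s : face_sum (face_sum g) s = 0.
Proof.
elim: s g => [//|x s IH] g /=.
rewrite (_ : face_sum g \o _ = fun t => g t + face_sum (g \o cons x) t)//.
by rewrite face_sumD IH addr0 addFF2.
Qed.

End list_cochains.

Lemma mem_delete (T : eqType) i (s : seq T) : {subset delete i s <= s}.
Proof.
elim: s i => [|x s IH] [|i]//= y; first by rewrite in_cons orbC => ->.
by rewrite !in_cons => /orP[->//|/IH ->]; rewrite orbT.
Qed.

Lemma map_delete (T T' : Type) (f : T -> T') i s :
  [seq f x | x <- delete i s] = delete i [seq f x | x <- s].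
Proof. by elim: s i => [|x s IH] [|i]//=; rewrite IH. Qed.

Lemma face_sum_map (T T' : Type) (f : T -> T') (g : seq T' -> 'F_2) s :
  face_sum (g \o map f) s = face_sum g (map f s).
Proof.
by rewrite !face_sumE size_map; apply: eq_bigr => i _; rewrite /= map_delete.
Qed.

(** Below, cochains are functions on lists of all sizes; a coboundary only sees
    the values in one dimension, on sublists. *)
Lemma eq_face_sum_size (T : Type) (g h : seq T -> 'F_2) s :
  (forall t, (size t).+1 = size s -> g t = h t) -> face_sum g s = face_sum h s.
Proof.
move=> gh; rewrite !face_sumE; apply: eq_bigr => i _; apply: gh.
by rewrite size_delete// prednK// (leq_ltn_trans _ (ltn_ord i)).
Qed.

Lemma eq_face_sum (T : eqType) (g h : seq T -> 'F_2) s :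
  (forall t, (size t).+1 = size s -> {subset t <= s} -> g t = h t) ->
  face_sum g s = face_sum h s.
Proof.
move=> gh; rewrite !face_sumE; apply: eq_bigr => i _; apply: gh.
  by rewrite size_delete// prednK// (leq_ltn_trans _ (ltn_ord i)).
exact: mem_delete.
Qed.

Section subdivision.
Context {T : Type} (bary : seq T -> T).
Implicit Types (g h : seq T -> 'F_2) (s : seq T).

(** The dual of the recursion sd s = b . sd (boundary of s), where b is a point
    chosen for s and the dot is the cone operation. The argument n stands for
    the size of s, on which the recursion runs. Nothing in the algebra depends
    on the choice of b. *)
Fixpoint subdiv_rec n g s : 'F_2 :=
  if n is n'.+1 then face_sum (subdiv_rec n' (g \o cons (bary s))) s else g s.

Definition subdiv g s := subdiv_rec (size s) g s.

(** The dual of T s = b . (s + T (boundary of s)), the chain homotopy between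
    the identity and subdivision. *)
Fixpoint subdiv_htpy_rec n g s : 'F_2 :=
  if n is n'.+1 then
    g (bary s :: s) + face_sum (subdiv_htpy_rec n' (g \o cons (bary s))) s
  else 0.

Definition subdiv_htpy g s := subdiv_htpy_rec (size s) g s.

Lemma subdiv_htpy_recD n g h s : subdiv_htpy_rec n (fun t => g t + h t) s =
  subdiv_htpy_rec n g s + subdiv_htpy_rec n h s.
Proof.
elim: n g h s => [|n IH] g h s /=; first by rewrite addr0.
rewrite addrACA -face_sumD; congr (_ + _); apply: eq_face_sum_size => t _.
exact: (IH (g \o cons (bary s)) (h \o cons (bary s))).
Qed.

Lemma subdiv0 g s : (forall t, size t = size s -> g t = 0) -> subdiv g s = 0.
Proof.
rewrite /subdiv; have [n sn] : exists n, size s = n by exists (size s).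
rewrite sn; elim: n g s sn => [|n IH] g s sn g0 /=; first exact: g0.
rewrite (@eq_face_sum_size _ _ (fun=> 0)); first by rewrite face_sumE big1.
move=> t; rewrite sn => -[tn]; apply: IH => // u un.
by apply: g0; rewrite /= un.
Qed.

Lemma subdiv_htpy0 g s :
  (forall t, size t = (size s).+1 -> g t = 0) -> subdiv_htpy g s = 0.
Proof.
rewrite /subdiv_htpy; have [n sn] : exists n, size s = n by exists (size s).
rewrite sn; elim: n g s sn => [//|n IH] g s sn g0 /=.
rewrite g0 ?add0r; last by rewrite /= sn.
rewrite (@eq_face_sum_size _ _ (fun=> 0)); first by rewrite face_sumE big1.
move=> t; rewrite sn => -[tn]; apply: IH => // u un.
by apply: g0; rewrite /= un.
Qed.

(** As the boundary of a cone b . z is z + b . (boundary of z), the boundary of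
    T s is s + T (boundary of s) + b . (boundary of s + boundary of
    T (boundary of s)). By induction the last bracket is sd (boundary of s),
    and its cone from b is sd s. The empty simplex makes the formula for cones
    true in all dimensions. *)
Lemma subdiv_htpyP g s :
  face_sum (subdiv_htpy g) s + subdiv_htpy (face_sum g) s = g s + subdiv g s.
Proof.
rewrite /subdiv /subdiv_htpy.
have [n sn] : exists n, size s = n by exists (size s).
elim: n g s sn => [|n IH] g s sn.
  by move/size0nil: sn => -> /=; rewrite !addFF2.
rewrite sn /=; set b := bary s; set g' := g \o cons b.
rewrite (_ : face_sum _ s = face_sum (subdiv_htpy_rec n g) s); last first.
  by apply: eq_face_sum_size => t; rewrite sn => -[->].
rewrite (_ : face_sum (subdiv_htpy_rec n (face_sum g \o cons b)) s =
  face_sum (fun t =>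
    subdiv_htpy_rec n g t + subdiv_htpy_rec n (face_sum g') t) s); last first.
  by apply: eq_face_sum_size => t _; rewrite -subdiv_htpy_recD.
rewrite face_sumD -/g'.
have -> : face_sum (subdiv_htpy_rec n (face_sum g')) s =
    face_sum g' s + face_sum (subdiv_rec n g') s.
  have -> : face_sum (subdiv_htpy_rec n (face_sum g')) s = face_sum (fun t =>
      g' t + subdiv_rec n g' t + face_sum (subdiv_htpy_rec (size t).-1 g') t) s.
    apply: eq_face_sum_size => t; rewrite sn => -[tn].
    rewrite -tn -IH//.
    rewrite (_ : face_sum (subdiv_htpy_rec _ _) t =
      face_sum (fun u => subdiv_htpy_rec (size u) g' u) t).
      by rewrite addrAC addFF2 add0r.
    by apply: eq_face_sum_size => u <-.
  rewrite face_sumD (_ : face_sum (fun t => face_sum _ t) s =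
      face_sum (face_sum (subdiv_htpy_rec n.-1 g')) s); last first.
    by apply: eq_face_sum_size => t; rewrite sn => -[->].
  by rewrite face_sumK addr0 face_sumD.
move: (g s) (face_sum g' s) (face_sum (subdiv_htpy_rec n g) s) (face_sum _ s).
move=> x y z w.
by rewrite addrCA addF2K -addrA addF2K.
Qed.

Lemma face_sum_subdiv g s : face_sum (subdiv g) s = subdiv (face_sum g) s.
Proof.
have sE h t : subdiv h t =
    h t + (face_sum (subdiv_htpy h) t + subdiv_htpy (face_sum h) t).
  by rewrite subdiv_htpyP addF2K.
rewrite sE [in RHS](_ : subdiv_htpy _ _ = 0); last first.
  by apply: subdiv_htpy0 => t _; exact: face_sumK.
rewrite (_ : subdiv g = fun t => g t + (face_sum (subdiv_htpy g) t +
  subdiv_htpy (face_sum g) t)); last exact/funext/sE.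
by rewrite !face_sumD face_sumK add0r addr0.
Qed.

End subdivision.

Section subdivision_map.
Context {T T' : Type} (bary : seq T -> T) (bary' : seq T' -> T') (f : T -> T').
Hypothesis bary_map : forall s, s <> [::] -> bary' (map f s) = f (bary s).

(** Needed for the faces of a simplex, whose subdivisions must agree with that
    of the simplex. *)
Lemma subdiv_map (g : seq T' -> 'F_2) s :
  subdiv bary (g \o map f) s = subdiv bary' g (map f s).
Proof.
rewrite /subdiv size_map.
have [n sn] : exists n, size s = n by exists (size s).
rewrite sn; elim: n g s sn => [//|n IH] g s sn /=.
rewrite -face_sum_map bary_map; last by move=> s0; rewrite s0 in sn.
by apply: eq_face_sum_size => t; rewrite sn => -[/IH]; exact.
Qed.

Lemma subdiv_htpy_map (g : seq T' -> 'F_2) s :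
  subdiv_htpy bary (g \o map f) s = subdiv_htpy bary' g (map f s).
Proof.
rewrite /subdiv_htpy size_map.
have [n sn] : exists n, size s = n by exists (size s).
rewrite sn; elim: n g s sn => [//|n IH] g s sn /=.
rewrite -face_sum_map bary_map; last by move=> s0; rewrite s0 in sn.
by congr (_ + _); apply: eq_face_sum_size => t; rewrite sn => -[/IH]; exact.
Qed.

End subdivision_map.

(** * Affine singular simplices *)

Section affine.
Context {R : realType}.

Lemma simplexP k (x : simplex R k) :
  (forall i, 0 <= val x 0 i) /\ \sum_i val x 0 i = 1.
Proof. exact: set_mem (valP x). Qed.

Lemma vertex_subproof k (i : 'I_k.+1) :
  (delta_mx 0 i : 'rV[R]_k.+1) \in std_simplex R k.+1.
Proof.
apply/mem_set; split=> [j|]; first by rewrite mxE ler0n.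
rewrite (bigD1 i)//= big1 => [|j /negPf ji]; first by rewrite mxE !eqxx addr0.
by rewrite mxE ji andbF.
Qed.

Definition vertex k (i : 'I_k.+1) : simplex R k :=
  exist _ (delta_mx 0 i) (vertex_subproof i).

Lemma center_subproof k :
  (const_mx k.+1%:R^-1 : 'rV[R]_k.+1) \in std_simplex R k.+1.
Proof.
apply/mem_set; split=> [j|]; first by rewrite mxE invr_ge0 ler0n.
under eq_bigr do rewrite mxE.
by rewrite sumr_const card_ord -[LHS]mulr_natl divff// pnatr_eq0.
Qed.

Definition center k : simplex R k :=
  exist _ (const_mx k.+1%:R^-1) (center_subproof k).

Definition affine_fun k m (s : seq (simplex R m)) (w : simplex R k) :
    'rV[R]_m.+1 :=
  \row_j \sum_i val w 0 i * val (nth (vertex ord0) s i) 0 j.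

Lemma affine_subproof k m (s : seq (simplex R m)) (w : simplex R k) :
  affine_fun s w \in std_simplex R m.+1.
Proof.
have [w0 w1] := simplexP w; apply/mem_set; split=> [j|].
  rewrite mxE; apply: sumr_ge0 => i _; apply: mulr_ge0 => //.
  exact: (simplexP _).1.
under eq_bigr do rewrite mxE.
rewrite exchange_big -[RHS]w1 /=; apply: eq_bigr => i _.
by rewrite -mulr_sumr (simplexP _).2 mulr1.
Qed.

(** The map that sends the i-th vertex to the i-th entry of s. It is total: the
    default entry makes sense of it when s has fewer than k + 1 entries. *)
Definition affine k m (s : seq (simplex R m)) (w : simplex R k) : simplex R m :=
  exist _ (affine_fun s w) (affine_subproof s w).

Lemma simplex_coord_continuous k i :
  continuous (fun w : simplex R k => val w 0 i).
Proof.
move=> x; apply: (@continuous_comp _ _ _ (val : simplex R k -> 'rV[R]_k.+1)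
    (fun y : 'rV[R]_k.+1 => y 0 i)); first exact: set_val_continuous.
exact: coord_continuous.
Qed.

Lemma sum_continuous (T : topologicalType) n (f : 'I_n -> T -> R) :
  (forall i, continuous (f i)) -> continuous (fun x => \sum_i f i x).
Proof.
move=> fc; apply: (@continuous_big R^o _ +%R 0 xpredT (@add_continuous R^o)
  T (index_enum _) f) => i _; exact: fc.
Qed.

Lemma affine_continuous k m (s : seq (simplex R m)) :
  continuous (@affine k m s).
Proof.
apply: set_type_continuous; apply: mx_continuous => i j.
rewrite (_ : (fun _ => _) = fun w : simplex R k =>
  \sum_i val w 0 i * val (nth (vertex ord0) s i) 0 j); last first.
  by apply/funext => x /=; rewrite mxE.
apply: sum_continuous => l x.
apply: (@cvgM R _ (nbhs x) _ (fun w : simplex R k => val w 0 l)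
  (fun=> val (nth (vertex ord0) s l) 0 j)); last exact: cvg_cst.
exact: simplex_coord_continuous.
Qed.

HB.instance Definition _ k m s :=
  isContinuous.Build _ _ (@affine k m s) (@affine_continuous k m s).

Definition bary m (s : seq (simplex R m)) : simplex R m :=
  affine s (center (size s).-1).

Definition vertices k := [seq vertex i | i <- enum 'I_k.+1].

Lemma size_vertices k : size (vertices k) = k.+1.
Proof. by rewrite size_map size_enum_ord. Qed.

Lemma nth_vertices k x0 (i : 'I_k.+1) : nth x0 (vertices k) i = vertex i.
Proof. by rewrite (nth_map ord0) ?size_enum_ord// nth_ord_enum. Qed.

Lemma affine_vertices k (w : simplex R k) : affine (vertices k) w = w.
Proof.
apply/val_inj/rowP => j; rewrite mxE (bigD1 j)//= big1 => [|i ij].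
  by rewrite nth_vertices mxE !eqxx mulr1 addr0.
by rewrite nth_vertices mxE eq_sym (negPf ij) mulr0.
Qed.

Lemma vertex_map_affine k m p (th : 'I_m.+1 -> 'I_p.+1) (s : seq (simplex R m))
  (w : simplex R k) : (size s = k.+1)%N ->
  vertex_map th (affine s w) = affine (map (vertex_map th) s) w.
Proof.
move=> sk; apply/val_inj/rowP => j; rewrite !mxE.
under eq_bigr do rewrite mxE.
rewrite exchange_big /=; apply: eq_bigr => i _.
by rewrite (nth_map (vertex ord0)) ?sk// mxE mulr_sumr.
Qed.

Lemma bary_map m p (th : 'I_m.+1 -> 'I_p.+1) (s : seq (simplex R m)) :
  s <> [::] -> bary (map (vertex_map th) s) = vertex_map th (bary s).
Proof.
move=> s0; rewrite /bary vertex_map_affine ?size_map ?prednK//.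
by case: s s0.
Qed.

Lemma affine_delete k m (s : seq (simplex R m)) (i : 'I_k.+2) (w : simplex R k) :
  affine s (vertex_map (lift i) w) = affine (delete i s) w.
Proof.
apply/val_inj/rowP => j; rewrite !mxE.
under eq_bigr do rewrite mxE mulr_suml.
rewrite (exchange_big_dep xpredT)//=; apply: eq_bigr => l _.
rewrite (bigD1 (lift i l))//= big1 ?addr0 ?nth_delete//.
by move=> l' /andP[/eqP ->]; rewrite eqxx.
Qed.

Lemma vertex_map_vertex k m (th : 'I_k.+1 -> 'I_m.+1) (i : 'I_k.+1) :
  vertex_map th (vertex i) = vertex (th i) :> simplex R m.
Proof.
apply/val_inj/rowP => j; rewrite !mxE eqxx /= (eq_sym j).
under eq_bigr do rewrite mxE eqxx.
have [<-|ji] := eqVneq (th i) j.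
  by rewrite (bigD1 i)//= eqxx big1 ?addr0// => l /andP[_ /negPf ->].
rewrite big1// => l /eqP lj; case: (eqVneq l i) => // li.
by rewrite -li lj eqxx in ji.
Qed.

Lemma vertices_delete k (i : 'I_k.+2) :
  map (vertex_map (lift i)) (vertices k) = delete i (vertices k.+1).
Proof.
apply: (@eq_from_nth _ (vertex ord0)) => [|j].
  by rewrite size_map size_delete ?size_vertices.
rewrite size_map size_vertices => jk; rewrite nth_delete.
rewrite (nth_map (vertex ord0)) ?size_vertices//.
rewrite (nth_vertices _ (Ordinal jk)) vertex_map_vertex.
by rewrite -(nth_vertices (vertex ord0) (lift i _)).
Qed.

Definition dist_le (D : R) m (x y : simplex R m) :=
  forall j, `|val x 0 j - val y 0 j| <= D.

Lemma dist_leC D m (x y : simplex R m) : dist_le D x y -> dist_le D y x.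
Proof. by move=> xy j; rewrite distrC. Qed.

Lemma dist_le1 m (x y : simplex R m) : dist_le 1 x y.
Proof.
move=> j; have b (z : simplex R m) : 0 <= val z 0 j <= 1.
  have [z0 z1] := simplexP z; rewrite z0 -[leRHS]z1 (bigD1 j)//= lerDl.
  by apply: sumr_ge0.
have := b x; have := b y; rewrite ler_norml; lra.
Qed.

Lemma affine_dist_le D k m (s : seq (simplex R m)) (w : simplex R k) z :
  size s = k.+1 -> (forall x, x \in s -> dist_le D z x) ->
  dist_le D z (affine s w).
Proof.
move=> sk sD j; have [w0 w1] := simplexP w; rewrite mxE.
rewrite -[val z 0 j]mul1r -w1 mulr_suml -sumrB.
rewrite (le_trans (ler_norm_sum _ _ _))// -[D]mul1r -w1 mulr_suml.
apply: ler_sum => i _; rewrite -mulrBr normrM (ger0_norm (w0 i)).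
by apply: ler_wpM2l => //; apply: sD; rewrite mem_nth// sk.
Qed.

(** The barycentre of k + 1 points is at distance at most k / (k + 1) times the
    diameter from each of them, since the point itself has weight 1 / (k + 1).
    The factor 1 - 1 / (K + 1) serves all the sizes up to K + 1, as is needed
    in the recursion over faces. *)
Lemma bary_dist_le K D m (s : seq (simplex R m)) z : (0 < size s <= K.+1)%N ->
  (forall x y, x \in s -> y \in s -> dist_le D x y) -> z \in s ->
  dist_le ((1 - K.+1%:R^-1) * D) z (bary s).
Proof.
move=> /andP[s0 sK] sD zs j; rewrite /bary.
case sk: (size s) s0 sK => [//|k] _ kK; rewrite [_.-1]/=.
have D0 : 0 <= D by apply: le_trans (sD z z zs zs j).
have [w0 w1] := simplexP (center k); rewrite mxE.
rewrite -[val z 0 j]mul1r -[X in X * _ - _]w1 mulr_suml -sumrB.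
rewrite (le_trans (ler_norm_sum _ _ _))//.
have iz : (index z s < k.+1)%N by rewrite -sk index_mem.
rewrite (bigD1 (Ordinal iz))//= nth_index// subrr normr0 add0r.
apply: (@le_trans _ _ (\sum_(i < k.+1 | i != Ordinal iz) k.+1%:R^-1 * D)).
  apply: ler_sum => i _; rewrite -mulrBr normrM (ger0_norm (w0 i)) mxE.
  by rewrite ler_wpM2l ?invr_ge0 ?ler0n//; apply: sD; rewrite ?mem_nth ?sk.
rewrite sumr_const cardC1 card_ord -[leLHS]mulr_natl mulrA ler_wpM2r//=.
have -> : k%:R / k.+1%:R = 1 - k.+1%:R^-1 :> R.
  by rewrite -[X in X - _](@divff _ k.+1%:R) ?pnatr_eq0// -natr1; ring.
by rewrite lerD2l lerN2 lef_pV2 ?posrE ?ltr0n// ler_nat.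
Qed.

(** Subdivision contracts diameters by the factor q. The points of a piece of
    the subdivision are averages of points of s, so every ball that contains s
    contains the piece. Applied to the faces of s and to a ball around the
    barycentre of s, this bounds the distances from the barycentre to the other
    points of the piece, and it is what the induction has to carry along. *)
Lemma subdiv_dist_le0 K D q m (g : seq (simplex R m) -> 'F_2) s :
  (size s <= K.+1)%N -> q = 1 - K.+1%:R^-1 ->
  (forall x y, x \in s -> y \in s -> dist_le D x y) ->
  (forall t, size t = size s ->
    (forall x y, x \in t -> y \in t -> dist_le (q * D) x y) ->
    (forall z r, (forall x, x \in s -> dist_le r z x) ->
      forall x, x \in t -> dist_le r z x) ->
    g t = 0) ->
  subdiv (@bary m) g s = 0.
Proof.
move=> + qE; have q0 : 0 <= q.
  by rewrite qE subr_ge0 invf_le1 ?ltr0n// ler1n.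
rewrite /subdiv; have [n sn] : exists n, size s = n by exists (size s).
rewrite sn; elim: n g s sn => [|n IH] g s sn nK sD gs /=.
  by apply: gs => // x y; rewrite (size0nil sn).
rewrite (@eq_face_sum _ _ (fun=> 0)); first by rewrite face_sumE big1.
move=> t; rewrite sn => -[tn] ts; apply: IH => //; first exact: ltnW.
  by move=> x y xt yt; apply: sD; exact: ts.
move=> u un uD ut; apply: gs => /=; first by rewrite un.
  have ub x : x \in u -> dist_le (q * D) (bary s) x.
    apply: ut => {}x /ts xs; apply: dist_leC; rewrite qE.
    by apply: bary_dist_le; rewrite // sn.
  have bb : dist_le (q * D) (bary s) (bary s).
    move=> j; rewrite subrr normr0; apply: mulr_ge0 => //.
    case: (s) sn sD => [//|x s'] _ sD'.
    by apply: le_trans (sD' x x _ _ j); rewrite ?normr_ge0// mem_head.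
  move=> x y; rewrite !in_cons => /predU1P[->|xu] /predU1P[->|yu] //.
  - exact: ub.
  - by apply/dist_leC/ub.
  - exact: uD.
move=> z r sr x; rewrite in_cons => /predU1P[->|].
  apply: affine_dist_le => //; rewrite sn//.
by apply: ut => {}x /ts; exact: sr.
Qed.

Lemma iter_subdiv_dist_le0 K D q m (g : seq (simplex R m) -> 'F_2) i s :
  q = 1 - K.+1%:R^-1 -> size s = K.+1 ->
  (forall t, size t = K.+1 ->
    (forall x y, x \in t -> y \in t -> dist_le (q ^+ i * D) x y) -> g t = 0) ->
  (forall x y, x \in s -> y \in s -> dist_le D x y) ->
  iter i (subdiv (@bary m)) g s = 0.
Proof.
move=> qE; elim: i D s => [|i IH] D s sK gt sD /=.
  by apply: gt => // x y xs ys; rewrite expr0 mul1r; exact: sD.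
apply: (subdiv_dist_le0 (K := K) _ qE sD); first by rewrite sK.
move=> t; rewrite sK => tK tD _; apply: IH tD => // u uK uD; apply: gt => //.
by move=> x y xu yu; rewrite exprSr -mulrA; exact: uD.
Qed.

End affine.

(** * Cocycles that vanish on small simplices *)

Section small_simplices.
Context {R : realType}.

Lemma simplex_nbhs m (x : simplex R m) U : nbhs x U ->
  exists2 e, 0 < e & forall y, dist_le e x y -> U y.
Proof.
rewrite nbhsE => -[B [[V oV <-] Vx] BU].
have /nbhs_ballP[e /= e0 eV] : nbhs (val x) V by exact: open_nbhs_nbhs.
exists (e / 2); first by rewrite divr_gt0.
move=> y xy; apply/BU/eV; split=> // i j; rewrite ord1.
by rewrite /ball /= (le_lt_trans (xy j))// ltr_pdivrMr// ltr_pMr// ltr1n.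
Qed.

Lemma simplex_compact m : compact (std_simplex R m.+1).
Proof.
pose cube := [set v : 'rV[R]_m.+1 | forall i, `[0, 1]%classic (v ord0 i)].
apply: (@subclosed_compact _ _ cube).
- rewrite (_ : std_simplex R m.+1 =
    \bigcap_(i in [set: 'I_m.+1]) [set x | 0 <= x 0 i] `&`
    [set x | \sum_i x 0 i = 1]); last first.
    apply/seteqP; split=> [x [x0 x1]|x [x0 x1]]; split=> // i.
      by move=> _; exact: x0.
    exact: (x0 i).
  apply: closedI.
    apply: closed_bigI => i _.
    apply: (@preimage_closed _ _ (fun x : 'rV[R]_m.+1 => x 0 i)
      [set y | 0 <= y]); last exact: closed_ge.
    by move=> x _; exact: coord_continuous.
  apply: (@preimage_closed _ _ (fun x : 'rV[R]_m.+1 => \sum_i x 0 i)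
    [set y | y = 1]); last exact: closed_eq.
  move=> x _; apply: sum_continuous => i; exact: coord_continuous.
- apply: (@rV_compact R m.+1 (fun=> `[0, 1]%classic)) => i.
  exact: segment_compact.
- move=> v [v0 v1] i; rewrite /= in_itv /= v0 -[leRHS]v1 (bigD1 i)//= lerDl.
  by apply: sumr_ge0.
Qed.

Lemma lebesgue_number m (X : topologicalType) (s : singular R X m)
    (U : set (set X)) :
  (forall A, U A -> open A) -> (forall x, exists2 A, U A & A x) ->
  exists2 e, 0 < e &
    forall x, exists2 A, U A & forall y, dist_le e x y -> A (s y).
Proof.
move=> Uo Ucover.
pose P e (v : 'rV[R]_m.+1) := exists2 A, U A & forall y : simplex R m,
  (forall j, `|v 0 j - val y 0 j| <= e) -> A (s y).
have ePnear : \forall e \near (0 : R)^'+, std_simplex R m.+1 `<=` P e.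
  apply: (compact_near_coveringP _).1 => [|v sv]; first exact: simplex_compact.
  pose x : simplex R m := exist _ v (mem_set sv).
  have [A UA Asx] := Ucover (s x).
  have [e e0 eA] : exists2 e, 0 < e & forall y, dist_le e x y -> A (s y).
    apply: simplex_nbhs; apply: (@cts_fun _ _ s x A).
    by apply: open_nbhs_nbhs; split=> //; exact: Uo.
  exists (ball v (e / 2), [set d | d < e / 2]) => /=.
    split; first by apply: nbhsx_ballx; rewrite divr_gt0.
    by apply: nbhs_right_lt; rewrite divr_gt0.
  case=> v' d /= [[_ v'v] de]; exists A => // y yd; apply: eA => j /=.
  have := v'v 0 j; rewrite /ball /= => vj; have := yd j => yj.
  by rewrite (le_trans (ler_distD (v' 0 j) _ _))//; lra.
have [e [e0 eP]] := filter_ex (filterI (nbhs_right_gt 0) ePnear).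
exists e => // x; have [A UA xA] := eP _ (set_mem (valP x)).
by exists A => // y xy; exact: xA.
Qed.

Context {Y : topologicalType}.

(** Transports c to lists of points of the domain of s. Being 0 in the other
    dimensions, it is a cochain on lists to which subdivision applies. *)
Definition on_affine k m (c : cochain R Y k) (s : singular R Y m) :
    seq (simplex R m) -> 'F_2 :=
  fun t => if size t == k.+1 then c (s \o affine t) else 0.

Lemma on_affine_vertices k (c : cochain R Y k) (s : singular R Y k) :
  on_affine c s (vertices k) = c s.
Proof.
rewrite /on_affine size_vertices eqxx; congr c.
by apply/continuousEP => x; rewrite /= affine_vertices.
Qed.

Lemma on_affine_restr k m p (c : cochain R Y k) (s : singular R Y p)
    (th : 'I_m.+1 -> 'I_p.+1) :
  on_affine c (restr th s) = on_affine c s \o map (vertex_map th).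
Proof.
apply/funext => t; rewrite /on_affine /= size_map; case: eqP => // tk.
by congr c; apply/continuousEP => x; rewrite /= vertex_map_affine.
Qed.

Lemma face_sum_on_affine k m (c : cochain R Y k) (s : singular R Y m) :
  face_sum (on_affine c s) = on_affine (coboundary c) s.
Proof.
apply/funext => t; rewrite face_sumE /on_affine; case: eqP => [tk|/eqP tk].
  rewrite tk; apply: eq_bigr => i _; rewrite size_delete ?tk// eqxx.
  congr c; apply/continuousEP => x /=.
  by rewrite affine_delete.
rewrite big1// => i _; rewrite size_delete// ifF//.
by apply: contraNF tk; case: (size t) i => [[]//|n] _ /= /eqP ->.
Qed.

Lemma iter_subdiv_map m p (th : 'I_m.+1 -> 'I_p.+1) n
    (g : seq (simplex R p) -> 'F_2) :
  iter n (subdiv (@bary R m)) (g \o map (vertex_map th)) =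
  iter n (subdiv (@bary R p)) g \o map (vertex_map th).
Proof.
elim: n => [//|n IH] /=; rewrite IH; apply/funext => t.
exact: (subdiv_map (@bary_map R m p th)).
Qed.

Lemma iter_subdiv_on_affine0 k m (c : cochain R Y k) (s : singular R Y m)
    (U : set (set Y)) :
  (forall A, U A -> open A) -> (forall x, exists2 A, U A & A x) ->
  (forall A (t : singular R Y k), U A -> range t `<=` A -> c t = 0) ->
  \forall n \near \oo, forall t, size t = k.+1 ->
    iter n (subdiv (@bary R m)) (on_affine c s) t = 0.
Proof.
move=> Uo Uc cU; have [e e0 eU] := lebesgue_number s Uo Uc.
pose q : R := 1 - k.+1%:R^-1.
have q01 : `|q| < 1.
  have k1 : k.+1%:R^-1 <= 1 :> R by rewrite invf_le1 ?ltr0n// ler1n.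
  have k0 : 0 < k.+1%:R^-1 :> R by rewrite invr_gt0 ltr0n.
  by rewrite /q ger0_norm ?subr_ge0// ltrBlDr ltrDl.
have := cvg_expr q01.
move=> /cvgrPdist_lt/(_ e e0); apply: filterS => n; rewrite sub0r normrN => qe.
move=> t tk.
apply: (iter_subdiv_dist_le0 (K := k) (D := 1) (q := q)) => //; last first.
  by move=> *; exact: dist_le1.
move=> u uk ud; rewrite /on_affine uk eqxx.
have [A UA eA] := eU (nth (vertex ord0) u 0).
apply: (cU A) => // _ [w _ <-] /=; apply: eA.
apply: affine_dist_le => // x xu j; apply: le_trans (ltW qe).
apply: (le_trans (ud _ _ _ _ _)) => //; first by rewrite mem_nth// uk.
by rewrite mulr1 ler_norm.
Qed.

(** Subdivision changes a cocycle c by the coboundary of T c. So if e is the sum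
    of T (sd^i c) over all i, the coboundary of e telescopes to c. On a given
    simplex the sum is finite, because sd^i c vanishes there as soon as the
    pieces of the i-th subdivision are small. *)
Theorem small_cocycle_coboundary k (c : cochain R Y k.+1) (U : set (set Y)) :
  (forall A, U A -> open A) -> (forall x, exists2 A, U A & A x) ->
  (forall A (t : singular R Y k.+1), U A -> range t `<=` A -> c t = 0) ->
  coboundary c = 0 -> exists e, c = coboundary e.
Proof.
move=> Uo Uc cU c0.
pose g m (s : singular R Y m) i := iter i (subdiv (@bary R m)) (on_affine c s).
have gN m (s : singular R Y m) : exists N, forall n, (N <= n)%N ->
    forall t, size t = k.+2 -> g m s n t = 0.
  have [N _ NP] := iter_subdiv_on_affine0 s Uo Uc cU.
  by exists N => n Nn; exact: NP.
have g_cocycle m (s : singular R Y m) i t : face_sum (g m s i) t = 0.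
  rewrite /g; elim: i t => [|i IH] t /=.
    by rewrite face_sum_on_affine c0 /on_affine; case: ifP.
  by rewrite face_sum_subdiv; apply: subdiv0 => u _; exact: IH.
pose h m (s : singular R Y m) i := subdiv_htpy (@bary R m) (g m s i).
have [N NP] := choice (gN k).
(* The number of terms depends on the simplex, but more terms do no harm. *)
pose e (s : singular R Y k) := \sum_(0 <= i < N s) h k s i (vertices k).
have eE s M : (N s <= M)%N -> e s = \sum_(0 <= i < M) h k s i (vertices k).
  move=> NM; rewrite (big_cat_nat _ NM)//= [X in _ + X]big_nat_cond.
  rewrite [X in _ + X]big1 ?addr0//.
  move=> i /andP[/andP[Ni _] _]; apply: subdiv_htpy0 => t; rewrite size_vertices.
  exact: NP.
exists e; apply/funext => s.
have [M0 M0P] := gN _ s.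
(* One number of terms that is good for s and for all its faces. *)
pose M := maxn M0 (\max_(j < k.+2) N (restr (lift j) s)).
rewrite /coboundary.
under eq_bigr => j _.
  rewrite (eE _ M); last by rewrite leq_max (leq_bigmax j) orbT.
  over.
rewrite exchange_big /=.
rewrite (_ : \sum_(0 <= i < M) _ =
    \sum_(0 <= i < M) (g _ s i (vertices k.+1) + g _ s i.+1 (vertices k.+1))).
  have -> n : \sum_(0 <= i < n) (g _ s i (vertices k.+1) +
      g _ s i.+1 (vertices k.+1)) = c s + g _ s n (vertices k.+1).
    elim: n => [|n IH]; first by rewrite big_geq// /g /= on_affine_vertices addFF2.
    by rewrite big_nat_recr//= IH -addrA addF2K.
  by rewrite M0P ?addr0 ?leq_maxl ?size_vertices.
apply: eq_bigr => i _.
have := subdiv_htpyP (@bary R _) (g _ s i) (vertices k.+1).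
rewrite [X in _ + X = _ -> _]subdiv_htpy0 ?addr0// => <-.
rewrite face_sumE size_vertices; apply: eq_bigr => j _.
rewrite /h /g on_affine_restr iter_subdiv_map -vertices_delete.
exact: (subdiv_htpy_map (@bary_map R _ _ _)).
Qed.

End small_simplices.

(** * Lifting to a double cover, and the Thom class of a line bundle *)

Section orbit_lifting.
Context {X : topologicalType} (g : free_involution X).

Definition orbit_map : continuousType X (orbit_space g) :=
  mkcts (@orbit_continuous X g).

Lemma orbit_open (W : set X) : open W -> open (orbit g @` W).
Proof.
move=> oW; rewrite /open /= /quotient_open.
rewrite (_ : _ @^-1` _ = W `|` (g : X -> X) @^-1` W); last first.
  apply/seteqP; split=> [x [y Wy /orbitP[<-|yx]]|x [Wx|Wgx]].
  - by left.
  - by right; rewrite /= -yx.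
  - by exists x.
  - by exists (g x) => //; apply/orbitP; right.
apply: openU => //; apply: open_comp => // x _; exact: inv_continuous.
Qed.

(** Over the image of an open set that meets each orbit at most once, the lift
    is unique, and it is continuous because the projection is open. *)
Lemma orbit_lift (T : topologicalType) (O : set X) (s : T -> orbit_space g) :
  open O -> (forall p, O p -> ~ O (g p)) -> continuous s ->
  (forall t, exists2 p, O p & orbit g p = s t) ->
  exists l : T -> X, [/\ continuous l, forall t, O (l t) &
                         forall t, orbit g (l t) = s t].
Proof.
move=> oO Og cs sO.
have sO' t : exists p, O p /\ orbit g p = s t by have [p] := sO t; exists p.
have [l lP] := choice sO'.
have Ol t : O (l t) by case: (lP t).
have sl t : orbit g (l t) = s t by case: (lP t).
exists l; split=> //; apply/continuousP => A oA.
rewrite (_ : l @^-1` A = s @^-1` (orbit g @` (A `&` O))).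
  by move/continuousP: cs; apply; apply: orbit_open; exact: openI.
apply/seteqP; split=> [t Alt|t [p [Ap Op]]]; first by exists (l t).
rewrite /= -sl => /orbitP[<- //|pl].
by case: (Og _ (Ol t)); rewrite -pl.
Qed.

End orbit_lifting.

Section heights.
Context {R : realType}.

Lemma continuous_add (T : topologicalType) (f h : T -> R) :
  continuous f -> continuous h -> continuous (fun x => f x + h x).
Proof.
by move=> fc hc x; apply: (@cvgD R R^o _ (nbhs x) _ f h _ _ (fc x) (hc x)).
Qed.

Lemma continuous_mul (T : topologicalType) (f h : T -> R) :
  continuous f -> continuous h -> continuous (fun x => f x * h x).
Proof.
by move=> fc hc x; apply: (@cvgM R _ (nbhs x) _ f h _ _ (fc x) (hc x)).
Qed.

Lemma continuous_opp (T : topologicalType) (f : T -> R) :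
  continuous f -> continuous (fun x => - f x).
Proof. by move=> fc x; apply: (@cvgN R R^o _ (nbhs x) _ f _ (fc x)). Qed.

Lemma continuous_abs (T : topologicalType) (f : T -> R) :
  continuous f -> continuous (fun x => `|f x|).
Proof. by move=> fc x; apply: (@cvg_norm R R^o _ (nbhs x) _ f _ (fc x)). Qed.

Definition height m (cs : seq R) (w : simplex R m) : R :=
  \sum_i val w 0 i * cs`_i.

Lemma height_continuous m cs : continuous (@height m cs).
Proof.
apply: sum_continuous => i x.
apply: (@cvgM R _ (nbhs x) _ (fun w : simplex R m => val w 0 i)
  (fun=> cs`_i)); last exact: cvg_cst.
exact: simplex_coord_continuous.
Qed.

Lemma height_face m cs (i : 'I_m.+2) (w : simplex R m) :
  height cs (vertex_map (lift i) w) = height (delete i cs) w.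
Proof.
rewrite /height; under eq_bigr do rewrite mxE mulr_suml.
rewrite (exchange_big_dep xpredT)//=; apply: eq_bigr => l _.
rewrite (bigD1 (lift i l))//= big1 ?addr0 ?nth_delete//.
by move=> l' /andP[/eqP ->]; rewrite eqxx.
Qed.

Lemma height_le m (c : R) cs (w : simplex R m) :
  (forall i : 'I_m.+1, c <= cs`_i) -> c <= height cs w.
Proof.
move=> cc; have [w0 w1] := simplexP w.
rewrite -[c]mul1r -w1 mulr_suml; apply: ler_sum => i _.
exact: ler_wpM2l.
Qed.

Lemma heightN m cs (w : simplex R m) : height (map -%R cs) w = - height cs w.
Proof.
rewrite /height -sumrN; apply: eq_bigr => i _; rewrite -mulrN; congr (_ * _).
have [im|im] := ltnP i (size cs); first by rewrite (nth_map 0).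
by rewrite !nth_default ?oppr0// size_map.
Qed.

Lemma vertex_map_cst k m (i : 'I_m.+1) (w : simplex R k) :
  vertex_map (fun=> i) w = vertex i.
Proof.
have [_ w1] := simplexP w; apply/val_inj/rowP => j; rewrite !mxE eqxx /=.
by have [_|_] := eqVneq j i; [rewrite w1|rewrite big_pred0].
Qed.

End heights.

Section thom.
Context {R : realType} {X : topologicalType} (g : free_involution X).
Hypothesis g_separated : forall x, exists O : set X,
  [/\ open O, O x & forall p, O p -> ~ O (g p)].
Variable u : cocycles R (@line_bundle R X g) 1.
Hypothesis u_thom : is_thom_cocycle u.

Let G := @line_inv R X g.

Definition bundle_simplex k (f : simplex R k -> X * R) (fc : continuous f) :
  singular R (@line_bundle R X g) k := orbit_map G \o mkcts fc.

(** The Thom cocycle on paths in the pullback of the bundle to the double cover,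
    which is trivial. Extending the definition to functions that are not
    continuous makes equal functions have equal values, whatever the proofs of
    continuity. *)
Definition path_value (f : simplex R 1 -> X * R) : 'F_2 :=
  if pselect (continuous f) is left fc
  then val u (bundle_simplex fc) else 0.

Lemma path_valueE f (fc : continuous f) :
  path_value f = val u (bundle_simplex fc).
Proof.
rewrite /path_value; case: pselect => // fc'.
by congr (val u _); exact/continuousEP.
Qed.

Lemma path_value_eq0 f : continuous f -> (forall w, (f w).2 != 0) ->
  path_value f = 0.
Proof.
move=> fc f0; rewrite path_valueE; apply: u_thom.1 => _ [w _ <-] /=.
exists (f w); [exact: f0|by []].
Qed.

Lemma path_value_inv f : continuous f -> path_value (G \o f) = path_value f.
Proof.
move=> fc; have gfc : continuous (G \o f).
  by move=> w; apply: continuous_comp; [exact: fc|exact: inv_continuous].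
rewrite !path_valueE; congr (val u _); apply/continuousEP => w /=.
by apply/orbitP; right.
Qed.

Lemma path_value_triangle (f : simplex R 2 -> X * R) : continuous f ->
  path_value (f \o vertex_map (lift ord0)) +
  path_value (f \o vertex_map (lift (lift ord0 ord0))) +
  path_value (f \o vertex_map (lift (lift ord0 (lift ord0 ord0)))) = 0.
Proof.
move=> fc; have ffc (i : 'I_3) : continuous (f \o vertex_map (lift i)).
  move=> w; apply: continuous_comp; [exact: vertex_map_continuous|exact: fc].
rewrite !path_valueE.
have /asboolP u0 := valP u.
have := congr1 (fun c : cochain R _ 2 => c (bundle_simplex fc)) u0.
rewrite /coboundary !big_ord_recl big_ord0 addr0 addrA => uE.
rewrite -[RHS]uE; congr (_ + _ + _); congr (val u _);
  exact/continuousEP.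
Qed.

(* The value on the straight path in the fibre over x from height a to b. *)
Let V x a b := path_value (fun w => (x, height [:: a; b] w)).
Let v0 : simplex R 1 := vertex ord0.
Let v1 : simplex R 1 := vertex ord_max.

Lemma vertical_continuous m x cs :
  continuous ((fun w => (x, height cs w)) : simplex R m -> X * R).
Proof.
apply: (@pair_continuous X R (simplex R m) (fun=> x) (height cs)).
  exact: cst_continuous.
exact: height_continuous.
Qed.

Lemma V_triangle x a b c : V x b c + V x a c + V x a b = 0.
Proof.
rewrite -[RHS](path_value_triangle (@vertical_continuous 2 x [:: a; b; c])).
by congr (_ + _ + _); congr path_value; apply/funext => w /=;
  rewrite height_face.
Qed.

Lemma V_pos x a b : 0 < a -> 0 < b -> V x a b = 0.
Proof.
move=> a0 b0; apply: path_value_eq0 => [|w]; first exact: vertical_continuous.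
rewrite /= gt_eqF// (@lt_le_trans _ _ (Num.min a b)) ?lt_min ?a0//.
by apply: height_le => -[[|[|//]] i] /=; rewrite ge_min lexx ?orbT.
Qed.

Lemma VN x a b : V (g x) (- a) (- b) = V x a b.
Proof.
rewrite /V -(path_value_inv (@vertical_continuous 1 x [:: a; b])).
by congr path_value; apply/funext => w; rewrite /= /line_inv_fun /= -heightN.
Qed.

(* The value of V x t c for any large c. *)
Let phi x (t : R) : 'F_2 := if 0 < t then 0 else if t == 0 then V x 0 1
  else V x 0 1 + V (g x) 0 1.

Lemma V_symm x a b : V x a b = V x b a.
Proof.
have := V_triangle x a a b; rewrite addFF2 add0r => aa.
by have := V_triangle x a b a; rewrite aa addr0 => /eqP; rewrite addr_eq0
  oppF2 => /eqP.
Qed.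

Lemma V_phi x s c : 0 < c -> V x s c = phi x s.
Proof.
have V0 y d : 0 < d -> V y 0 d = V y 0 1.
  move=> d0; apply/addF2_eq0; rewrite addrC.
  by have := V_triangle y 0 1 d; rewrite (V_pos _ ltr01 d0) add0r addrC.
move=> c0; rewrite /phi; have [s0|s0|->] := ltrgt0P s.
- exact: V_pos.
- apply/addF2_eq0; have := V_triangle x s 0 c.
  rewrite V0// [V x s 0]V_symm -(VN x 0 s) oppr0 V0 ?oppr_gt0//.
  by move=> <-; rewrite addrCA addrA.
- exact: V0.
Qed.

(** Lift the path (l, k) by the height D, which takes it to heights at least 1.
    The square between the path and its lift is made of two triangles that share
    the diagonal M. As the Thom cocycle vanishes on the lifted path, its value
    on the path is the sum of the values on the two vertical sides. *)
Lemma path_value_phi (l : simplex R 1 -> X) (k : simplex R 1 -> R) :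
  continuous l -> continuous k ->
  path_value (fun w => (l w, k w)) = phi (l v0) (k v0) + phi (l v1) (k v1).
Proof.
move=> lc kc; pose D w : R := `|k w| + 1 - k w.
have Dc : continuous D.
  apply: continuous_add; last exact: continuous_opp.
  apply: continuous_add; [exact: continuous_abs|exact: cst_continuous].
pose f (th : 'I_3 -> 'I_2) cs (w : simplex R 2) :=
  (l (vertex_map th w), k (vertex_map th w) + D (vertex_map th w) * height cs w).
have fc th cs : continuous (f th cs).
  have comp (T : topologicalType) (p : simplex R 1 -> T) :
      continuous p -> continuous (p \o vertex_map th).
    move=> pc w; apply: continuous_comp; last exact: pc.
    exact: vertex_map_continuous.
  apply: (@pair_continuous X R (simplex R 2) (l \o vertex_map th) _).
    exact: comp.
  apply: continuous_add; first exact: (comp _ k).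
  apply: continuous_mul; [exact: (comp _ D)|exact: height_continuous].
have face th cs i th' cs' : th \o lift i =1 th' -> delete i cs = cs' ->
    f th cs \o vertex_map (lift i) = fun w : simplex R 1 =>
    (l (vertex_map th' w), k (vertex_map th' w) +
     D (vertex_map th' w) * height cs' w).
  move=> /funext <- <-; apply/funext => w; rewrite /f /= height_face.
  by rewrite -[vertex_map (th \o lift i)]vertex_map_comp.
have idE (w : simplex R 1) : vertex_map id w = w.
  apply/val_inj/rowP => j; rewrite mxE (big_pred1 j)// => i.
pose M := path_value (fun w => (l w, k w + D w * height [:: 0; 1] w)).
have VE i : path_value (fun w => (l (vertex_map (fun=> i) w),
    k (vertex_map (fun=> i) w) + D (vertex_map (fun=> i) w) *
    height [:: 0; 1] w)) = phi (l (vertex i)) (k (vertex i)).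
  rewrite -(@V_phi _ _ (`|k (vertex i)| + 1)) ?ltr_wpDl//.
  congr path_value; apply/funext => w; rewrite vertex_map_cst; congr (_, _).
  have [_] := simplexP w.
  rewrite /height !big_ord_recl !big_ord0 /= /D addr0 => w1.
  have -> : val w 0 ord0 = 1 - val w 0 (lift ord0 ord0) by rewrite -w1 addrK.
  by ring.
have t1 := path_value_triangle (fc (fun i => if (i <= 1)%N then ord0 else ord_max)
  [:: 0; 1; 1]).
have t2 := path_value_triangle (fc (fun i => if (i < 1)%N then ord0 else ord_max)
  [:: 0; 0; 1]).
have ord2 (i : 'I_2) : i = ord0 \/ i = ord_max.
  by case: i => -[|[|//]] i; [left|right]; apply: ord_inj.
rewrite (face _ _ _ id [:: 1; 1]) in t1 => //; last first.
  by move=> i; have [->|->] := ord2 i; apply/val_inj.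
rewrite (face _ _ _ id [:: 0; 1]) in t1 => //; last first.
  by move=> i; have [->|->] := ord2 i; apply/val_inj.
rewrite (face _ _ _ (fun=> ord0) [:: 0; 1]) in t1 => //; last first.
  by move=> i; have [->|->] := ord2 i; apply/val_inj.
rewrite (face _ _ _ (fun=> ord_max) [:: 0; 1]) in t2 => //.
rewrite (face _ _ _ id [:: 0; 1]) in t2 => //; last first.
  by move=> i; have [->|->] := ord2 i; apply/val_inj.
rewrite (face _ _ _ id [:: 0; 0]) in t2 => //; last first.
  by move=> i; have [->|->] := ord2 i; apply/val_inj.
have idM cs : path_value (fun w => (l (vertex_map id w), k (vertex_map id w) +
    D (vertex_map id w) * height cs w)) =
    path_value (fun w => (l w, k w + D w * height cs w)).
  by congr path_value; apply/funext => w; rewrite idE.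
have top : path_value (fun w => (l w, k w + D w * height [:: 1; 1] w)) = 0.
  have heq w : k w + D w * height [:: 1; 1] w = `|k w| + 1.
    have [_] := simplexP w.
    rewrite /height !big_ord_recl !big_ord0 /= /D addr0 !mulr1 addr0 => ->.
    by ring.
  apply: path_value_eq0 => w /=; last by rewrite heq gt_eqF// ltr_wpDl.
  move: w; apply: (@pair_continuous X R (simplex R 1) l _) => //.
  rewrite (_ : (fun w => _) = fun w => `|k w| + 1); last exact/funext.
  apply: continuous_add; [exact: continuous_abs|exact: cst_continuous].
have bot : path_value (fun w => (l w, k w + D w * height [:: 0; 0] w)) =
    path_value (fun w => (l w, k w)).
  congr path_value; apply/funext => w; congr (_, _).
  by rewrite /height !big_ord_recl !big_ord0 /= !mulr0 !addr0 mulr0 addr0.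
rewrite idM VE idM top add0r in t1; rewrite idM VE idM bot in t2.
rewrite -(addF2_eq0 t1); apply/esym/addF2_eq0.
by rewrite addrAC -[RHS]t2 addrAC [X in X + _]addrC.
Qed.

(** The sum is the value of the Thom cocycle across the zero section. If it were
    0, phi x would vanish away from height 0, hence define a relative 0-cochain
    of the fibre; by path_value_phi its coboundary would be the Thom cocycle on
    the fibre. *)
Lemma thom_fibre x : V x 0 1 + V (g x) 0 1 = 1.
Proof.
have [s0|//] := F2_case (V x 0 1 + V (g x) 0 1); case: (u_thom.2 (orbit g x)).
pose B e := if e == orbit G (x, 0) then V x 0 1 else 0.
have BE t : B (orbit G (x, t)) = phi x t.
  rewrite /B /phi s0; have [t0|t0|->] := ltrgt0P t; rewrite ?eqxx// ifF//.
    by apply/eqP => /orbitP[[tE]|[/esym/inv_free]]; rewrite ?tE ?ltxx in t0 *.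
  by apply/eqP => /orbitP[[tE]|[/esym/inv_free]]; rewrite ?tE ?ltxx in t0 *.
exists (fun s : singular R _ 0 => B (s (vertex ord0))); split.
  move=> s sx; have [_ [[y t] /= t0 ytE]] : (line_fiber (orbit g x) `&`
    line_nonzero (g:=g))
    (s (vertex ord0)) by apply: sx; exists (vertex ord0).
  rewrite /B -ytE ifF//; apply/eqP => /orbitP[[_ tE]|[_ tE]].
    by rewrite tE eqxx in t0.
  by rewrite tE oppr0 eqxx in t0.
move=> s sx.
have [W [oO Ox Og]] := g_separated x.
have sfib w : exists t, orbit G (x, t) = s w.
  have : line_fiber (orbit g x) (s w) by apply: sx; exists w.
  rewrite /line_fiber /=; have [[y t] <-] := orbit_surj (s w).
  rewrite line_projE => /orbitP[->|->]; first by exists t.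
  by exists (- t); apply/orbitP; right; rewrite /= /line_inv_fun /= inv_involutive.
have [l [lc lO ls]] : exists l : simplex R 1 -> X * R,
    [/\ continuous l, forall w, W (l w).1 & forall w, orbit G (l w) = s w].
  apply: (@orbit_lift _ G _ (fst @^-1` W)).
  - by apply: open_comp => // p _; exact: cvg_fst.
  - by move=> p /=; exact: Og.
  - exact: cts_fun.
  - by move=> w; have [t tE] := sfib w; exists (x, t).
have lx w : (l w).1 = x.
  have [t] := sfib w; rewrite -ls => /orbitP[<- //|xE].
  by case: (Og _ (lO w)); move: (congr1 fst xE) => /= <-.
have usE : val u s = B (s v0) + B (s v1).
  have -> : val u s = path_value l.
    by rewrite path_valueE; congr (val u _); apply/continuousEP => w; rewrite -ls.
  rewrite (_ : l = fun w => ((l w).1, (l w).2)); last first.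
    by apply/funext => w; case: (l w).
  rewrite path_value_phi; last 2 first.
  - by move=> w; apply: continuous_comp; [exact: lc|exact: cvg_fst].
  - by move=> w; apply: continuous_comp; [exact: lc|exact: cvg_snd].
  have lE w : B (s w) = phi x (l w).2.
    by rewrite -BE -ls -(lx w); case: (l w).
  by rewrite !lx -!lE.
rewrite [LHS](_ : _ = val u s - \sum_(i < 2)
  B (restr (lift i) s (vertex ord0)))// usE big_ord_recl big_ord1 /=.
rewrite !vertex_map_vertex.
rewrite [B _ + B _]addrC; apply/eqP; rewrite subr_eq0; apply/eqP.
by congr (B (s (vertex _)) + B (s (vertex _))); apply/val_inj.
Qed.

(** The function b is the Thom cocycle on the path from 0 to 1 in the fibre.
    These relations determine the class of the cocycle: for two such functions
    b, the difference is invariant and so comes from the orbit space. *)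
Lemma thom_pullback : exists b : X -> 'F_2, (forall x, b x + b (g x) = 1) /\
  forall l : singular R X 1,
    val (pull_cocycle (zero_section g) u) (pull_singular (orbit_map g) l) =
    b (l (vertex ord0)) + b (l (vertex ord_max)).
Proof.
exists (fun x => V x 0 1); split=> [|l]; first exact: thom_fibre.
rewrite /= /pull_cochain.
have lc : continuous (fun w => (l w, 0 : R)).
  apply: (@pair_continuous X R (simplex R 1) l (fun=> 0)).
    exact: cts_fun.
  exact: cst_continuous.
rewrite (_ : pull_singular _ _ = bundle_simplex lc); last first.
  by apply/continuousEP => w; exact: zero_section_funE.
rewrite -path_valueE path_value_phi; last 2 first.
- exact: cts_fun.
- exact: cst_continuous.
by rewrite /phi ltxx eqxx.
Qed.

End thom.

(** * Cochains of vertices around a sphere *)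

Section alternating.
Context {T : Type} (S : nat -> T -> 'F_2).

(** The cup product of the coboundaries of the 0-cochains
    S j, ..., S (j + m - 1) on simplices of dimension m. *)
Fixpoint sign_cup j m (l : seq T) : 'F_2 :=
  if m is m'.+1 then
    if l is y :: l' then (S j y + S j (head y l')) * sign_cup j.+1 m' l' else 0
  else 1.

Lemma face_sum_sign_cup j m l : size l = m.+2 -> face_sum (sign_cup j m) l = 0.
Proof.
elim: m j l => [|m IH] j [//|y [//|y' l]] [lm].
  by case: l lm => //= _; rewrite !addr0 addFF2.
have lE : face_sum (sign_cup j.+1 m) (y' :: l) = 0 by apply: IH; rewrite /= lm.
case: l lm lE => [//|h l] lm.
rewrite !(face_sum_cons _ y) !(face_sum_cons _ y').
set D := face_sum _ _ => lE.
rewrite (_ : face_sum _ _ = (S j y + S j y') * D); last first.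
  rewrite -face_sumZ; apply: eq_face_sum_size => t tl.
  by [].
move: lE => /addF2_eq0 <- /=.
move: (sign_cup _ _ _) => z.
rewrite -!mulrDl [X in _ + X]addrACA addFF2 add0r [X in _ + X]addrC.
by rewrite addFF2 mul0r.
Qed.

End alternating.

Lemma sign_cup_neq0 (T : eqType) (S : nat -> T -> 'F_2) j m l i :
  size l = m.+1 -> sign_cup S j m l != 0 -> (j <= i < j + m)%N ->
  exists y y', [/\ y \in l, y' \in l & S i y != S i y'].
Proof.
elim: m j l => [|m IH] j [//|y l] /= [lm]; first by rewrite addn0; lia.
case: l lm => [//|y' l] lm; rewrite mulf_eq0 negb_or => /andP[Sj Sl] ji.
have [ij|ij] := eqVneq i j.
  exists y, y'; rewrite !inE !eqxx orbT ij; split=> //.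
  by rewrite -subr_eq0 oppF2.
have [|y1 [y2 [l1 l2 S12]]] := IH j.+1 _ lm Sl; first by lia.
by exists y1, y2; split => //; rewrite inE ?l1 ?l2 orbT.
Qed.

Lemma sign_cup_map (T : Type) (T' : eqType) (S : nat -> T -> 'F_2)
    (S' : nat -> T' -> 'F_2) (f : T' -> T) j m l :
  size l = m.+1 ->
  (forall i y z, y \in l -> z \in l ->
    S i (f y) + S i (f z) = S' i y + S' i z) ->
  sign_cup S j m (map f l) = sign_cup S' j m l.
Proof.
elim: m j l => [//|m IH] j [//|y [//|y' l]] [lm] SS /=.
rewrite -SS ?inE ?eqxx ?orbT//; congr (_ * _).
apply: (IH j.+1 (y' :: l)); first by rewrite /= lm.
by move=> i z z' zl z'l; apply: SS; rewrite inE (zl, z'l) orbT.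
Qed.

Section prism.
Context {T Z : Type} (F G : T -> Z).

(** The sum of s over the simplices F x_0, ..., F x_i, G x_i, ..., G x_m, which
    triangulate the prism between the images of l under F and G. *)
Fixpoint prism (s : seq Z -> 'F_2) (l : seq T) : 'F_2 :=
  if l is x :: l' then s (F x :: G x :: map G l') + prism (s \o cons (F x)) l'
  else 0.

Lemma prismD s s' l : prism (fun t => s t + s' t) l = prism s l + prism s' l.
Proof.
elim: l s s' => [|x l IH] s s' /=; first by rewrite addr0.
rewrite addrACA; congr (_ + _).
exact: (IH (s \o cons (F x)) (s' \o cons (F x))).
Qed.

Lemma prismP s l :
  face_sum (prism s) l + prism (face_sum s) l = s (map F l) + s (map G l).
Proof.
elim: l s => [|x l IH] s /=; first by rewrite !addFF2.
rewrite (_ : face_sum (prism s \o cons x) l =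
    face_sum (s \o cons (F x) \o cons (G x)) (map G l) +
    face_sum (prism (s \o cons (F x))) l); last first.
  by rewrite -face_sum_map -face_sumD.
rewrite (_ : face_sum s \o cons (F x) =
  fun t => s t + face_sum (s \o cons (F x)) t)//.
rewrite prismD.
have /= E := IH (s \o cons (F x)).
have F2E (a b c e f h : 'F_2) :
    a + (b + c) + (e + (f + b) + (a + h)) = c + h + f + e.
  by move: (F2_case a) (F2_case b) (F2_case c) (F2_case e) (F2_case f)
    (F2_case h) => [->|->] [->|->] [->|->] [->|->] [->|->] [->|->]; apply: ord_inj.
by rewrite F2E E -[X in X + _]addrA addFF2 addr0.
Qed.

End prism.

Lemma eq_prism (T : Type) (Z : eqType) (F G : T -> Z) s s' l :
  (forall t, size t = (size l).+1 -> {subset t <= map F l ++ map G l} ->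
    s t = s' t) ->
  prism F G s l = prism F G s' l.
Proof.
elim: l s s' => [//|x l IH] s s' ss' /=; congr (_ + _).
  apply: ss' => [|z]; first by rewrite /= size_map.
  by rewrite !(inE, mem_cat) => /or3P[->|->|->]; rewrite ?orbT.
apply: IH => t tl tFG /=; apply: ss' => [|z]; first by rewrite /= tl.
rewrite inE => /orP[/eqP->|/tFG]; first by rewrite mem_head.
by rewrite !(inE, mem_cat) => /orP[]->; rewrite ?orbT.
Qed.

Section sphere_cochain.
Context {R : realType} {k : nat}.
Implicit Types (x y z : 'rV[R]_k.+1) (l : seq 'rV[R]_k.+1) (e : R).

Definition sup_close e y z := forall i, `|y 0 i - z 0 i| < e.
Definition sup_norm_ge e y := exists i, e <= `|y 0 i|.

(** The sign of the coordinate j, as an element of F_2. The fallback to another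
    coordinate makes it change under y |-> - y also where the coordinate j
    vanishes; the choice by pick is good for this because it only depends on the
    set of nonzero coordinates. *)
Definition sgn j y : 'F_2 :=
  let i : 'I_k.+1 := inord j in
  (0 < y 0 (if y 0 i != 0 then i else odflt i [pick i' | y 0 i' != 0]))%R%:R.

Lemma sgnN e j y : 0 < e -> sup_norm_ge e y -> sgn j (- y) = sgn j y + 1.
Proof.
move=> e0 [i0 yi0]; rewrite /sgn; set i : 'I_k.+1 := inord j.
have NE i' : ((- y) 0 i' != 0) = (y 0 i' != 0) by rewrite mxE oppr_eq0.
rewrite (eq_pick NE) NE; set i1 := (if _ then _ else _).
have yi1 : y 0 i1 != 0.
  rewrite /i1; case: ifP => // _; case: pickP => //= /(_ i0)/negbFE/eqP yE.
  by rewrite yE normr0 leNgt e0 in yi0.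
rewrite mxE oppr_gt0; move: yi1; rewrite neq_lt.
by case: ltrgt0P => //= _ _; [rewrite addFF2|rewrite add0r].
Qed.

Lemma sgn_change j y z : sgn j y != sgn j z ->
  y 0 (inord j) * z 0 (inord j) <= 0.
Proof.
apply: contraNT; rewrite -ltNge /sgn => yz.
have [y0 z0] : y 0 (inord j) != 0 /\ z 0 (inord j) != 0.
  by split; apply/eqP => E; rewrite E ?mul0r ?mulr0 ltxx in yz.
rewrite y0 z0; have [yp|yn|E] := ltrgt0P (y 0 (inord j)).
- by rewrite pmulr_rgt0 in yz => //; rewrite yz.
- by rewrite nmulr_rgt0 in yz => //; rewrite ltNge ltW.
- by rewrite E eqxx in y0.
Qed.

Lemma close_small e l i y z :
  {in l &, forall y z, sup_close e y z} -> y \in l -> z \in l ->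
  y 0 i * z 0 i <= 0 -> {in l, forall x, `|x 0 i| < e}.
Proof.
move=> lc yl zl yz x xl.
have := lc x y xl yl i; have := lc x z xl zl i.
rewrite !ltr_norml => /andP[xz1 xz2] /andP[xy1 xy2].
have [y0|y0] := lerP 0 (y 0 i); have [z0|z0] := lerP 0 (z 0 i).
- have [y00|z00] : y 0 i = 0 \/ z 0 i = 0.
    have := mulr_ge0 y0 z0; rewrite le_eqVlt ltNge yz orbF eq_sym mulf_eq0.
    by move=> /orP[]/eqP; [left|right].
    by apply/andP; split; lra.
  by apply/andP; split; lra.
- by apply/andP; split; lra.
- by apply/andP; split; lra.
- by have := nmulr_rgt0 (z 0 i) y0; rewrite z0 ltNge yz.
Qed.

(** A generator of the top cohomology of the sphere: it detects the small
    simplices on which all the coordinates but the last one change sign, in order. These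
    lie near the last axis, and the first factor selects its positive half. *)
Definition axis_cochain l : 'F_2 :=
  (0 < head 0 l 0 ord_max)%R%:R * sign_cup sgn 0 k l.

Lemma sign_cup_small e l : size l = k.+1 ->
  {in l &, forall y z, sup_close e y z} -> sign_cup sgn 0 k l != 0 ->
  forall i : 'I_k.+1, i != ord_max -> {in l, forall y, `|y 0 i| < e}.
Proof.
move=> lk lc l0 i ik.
have [|y [z [yl zl]]] := sign_cup_neq0 (i := i) lk l0.
  by rewrite leq0n add0n /= ltn_neqAle -ltnS ltn_ord andbT.
by move=> /sgn_change; rewrite inord_val; exact: close_small.
Qed.

(** If the last coordinate has a constant sign on the vertices of l, the first
    factor is constant and the second one is a cocycle. Otherwise the last
    coordinate is small on l; then the second factor vanishes on each face, for
    a face on which the other coordinates change sign has only small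
    coordinates. *)
Lemma face_sum_axis_cochain e l : size l = k.+2 ->
  {in l &, forall y z, sup_close e y z} -> {in l, forall y, sup_norm_ge e y} ->
  face_sum axis_cochain l = 0.
Proof.
move=> lk lc lf.
have [c|] := pselect (forall y z, y \in l -> z \in l ->
    (0 < y 0 ord_max) = (0 < z 0 ord_max)).
  rewrite (@eq_face_sum _ _
      (fun t => (0 < head 0 l 0 ord_max)%R%:R * sign_cup sgn 0 k t)).
    by rewrite face_sumZ face_sum_sign_cup// mulr0.
  move=> t; rewrite lk => -[]; case: t => [//|y t] tk tl.
  congr ((nat_of_bool _)%:R * _) => /=.
  apply: (c y (head 0 l)); first by rewrite tl// mem_head.
  by rewrite -nth0 mem_nth// lk.
move=> /existsNP[y /existsNP[z /not_implyP[yl /not_implyP[zl yz]]]].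
have small : {in l, forall x, `|x 0 ord_max| < e}.
  apply: (close_small lc yl zl); apply: contra_notT yz; rewrite -ltNge.
  have [y0|y0|->] := ltrgt0P (y 0 ord_max); last by rewrite mul0r ltxx.
    by rewrite pmulr_rgt0.
  by rewrite nmulr_rgt0// => z0; rewrite ltNge ltW.
rewrite (@eq_face_sum _ _ (fun=> 0)); first by rewrite face_sumE big1.
move=> t; rewrite lk => -[tk] tl; rewrite /axis_cochain.
have [->|t0] := eqVneq (sign_cup sgn 0 k t) 0; first by rewrite mulr0.
have tc : {in t &, forall y z, sup_close e y z}.
  by move=> ? ? /tl ? /tl ?; exact: lc.
case: t tk tl t0 tc => [//|x t] tk tl t0 tc.
have xl := tl x (mem_head _ _).
have [i] := lf x xl; rewrite leNgt; case: (eqVneq i ord_max) => [->|im].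
  by rewrite small.
by rewrite (sign_cup_small tk tc t0)// mem_head.
Qed.

(** Where the product of sign changes is nonzero, the last coordinate is not 0,
    so that exactly one of y and - y is near the positive half-axis. *)
Lemma axis_cochainN e l : 0 < e -> size l = k.+1 ->
  {in l &, forall y z, sup_close e y z} -> {in l, forall y, sup_norm_ge e y} ->
  axis_cochain l + axis_cochain (map -%R l) = sign_cup sgn 0 k l.
Proof.
move=> e0 lk lc lf; rewrite /axis_cochain.
rewrite (@sign_cup_map _ _ sgn sgn -%R 0 k l lk); last first.
  by move=> j y z /lf/sgnN yN /lf/sgnN zN; rewrite yN// zN// addrACA addFF2 addr0.
rewrite -mulrDl.
have [->|l0] := eqVneq (sign_cup sgn 0 k l) 0; first by rewrite mulr0.
case: l lk lc lf l0 => [//|y l] lk lc lf l0 /=.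
have [i yi] := lf y (mem_head _ _).
have im : i = ord_max.
  apply/eqP; apply: contraTT yi => im; rewrite -ltNge.
  by apply: (sign_cup_small lk lc l0); rewrite ?mem_head.
have : y 0 ord_max != 0.
  by apply/eqP => E; rewrite im E normr0 leNgt e0 in yi.
rewrite mxE oppr_gt0.
by case: ltrgt0P => //= _ _; rewrite ?addr0 ?add0r mul1r.
Qed.

End sphere_cochain.

(** * Locally cohomologous maps *)

Section local_cochains.
Context {R : realType} {X : topologicalType} {k : nat}.
Implicit Types F G H : X -> 'rV[R]_k.+1.

(** The pullbacks of axis_cochain under F and G agree in Alexander-Spanier
    cohomology: their difference is a coboundary on lists of points that are
    close to each other, where the meaning of close may vary with the place. *)
Definition locally_cohomologous F G := exists e : seq X -> 'F_2,
  forall z : X, exists2 O, nbhs z O & forall l, size l = k.+1 ->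
    (forall x, x \in l -> O x) ->
    face_sum e l = axis_cochain (map F l) + axis_cochain (map G l).

Lemma locally_cohomologous_refl F : locally_cohomologous F F.
Proof.
exists (fun=> 0) => z; exists setT; first exact: filterT.
by move=> l _ _; rewrite addFF2 face_sumE big1.
Qed.

Lemma locally_cohomologous_trans F G H : locally_cohomologous F G ->
  locally_cohomologous G H -> locally_cohomologous F H.
Proof.
move=> [e eP] [e' eP']; exists (fun l => e l + e' l) => z.
have [U zU UP] := eP z; have [U' zU' UP'] := eP' z.
exists (U `&` U'); first exact: filterI.
move=> l lk lU; rewrite face_sumD UP ?UP' //; try by move=> x /lU[].
by rewrite -addrA addF2K.
Qed.

Lemma coord_map_continuous F i j : continuous F -> continuous (fun x => F x i j).
Proof.
move=> Fc x; apply: (@continuous_comp _ _ _ F (fun y : 'rV[R]_k.+1 => y i j)).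
  exact: Fc.
exact: coord_continuous.
Qed.

Lemma sup_close_near (e : R) F z : 0 < e -> continuous F ->
  \forall x \near z, sup_close e (F x) (F z).
Proof.
move=> e0 Fc; apply: filter_forall => i.
have /(@cvgrPdist_lt R R^o)/(_ e e0) := @coord_map_continuous F 0 i Fc z.
apply: filterS => x.
by rewrite distrC.
Qed.

(** The lists of vertices in the prism between F and G consist of points that are
    close to each other and away from 0, and axis_cochain is a cocycle on
    these. *)
Lemma locally_cohomologous_close (e : R) F G :
  0 < e -> continuous F -> continuous G ->
  (forall x, sup_norm_ge e (F x)) -> (forall x, sup_norm_ge e (G x)) ->
  (forall x, sup_close (e / 2) (F x) (G x)) -> locally_cohomologous F G.
Proof.
move=> e0 Fc Gc Ff Gf FG; exists (prism F G axis_cochain) => z.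
have e4 : 0 < e / 4 by rewrite divr_gt0.
exists [set x | sup_close (e / 4) (F x) (F z) /\ sup_close (e / 4) (G x) (G z)].
  by apply: filterI; exact: sup_close_near.
move=> l lk lz; rewrite -prismP [X in _ + X](_ : _ = 0) ?addr0//.
rewrite (@eq_prism _ _ _ _ _ (fun=> 0)) => [|t].
  by elim: l {lk lz} => [//|x l IH] /=; rewrite add0r.
rewrite lk => tk tFG; apply: (face_sum_axis_cochain (e := e) tk).
  move=> y y' /tFG + /tFG; rewrite !mem_cat => yFG yFG' i.
  have near_z v : (v \in map F l) || (v \in map G l) ->
      `|v 0 i - F z 0 i| < e / 4 \/ `|v 0 i - G z 0 i| < e / 4.
    by move=> /orP[]/mapP[x /lz[xF xG] ->]; [left|right].
  have := FG z i.
  by case: (near_z _ yFG) => + ; case: (near_z _ yFG') => +;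
    rewrite !ltr_norml => /andP[? ?] /andP[? ?] /andP[? ?]; apply/andP; split; lra.
move=> y /tFG; rewrite mem_cat => /orP[]/mapP[x _ ->]; [exact: Ff|exact: Gf].
Qed.

(** The segment is cut in N + 1 steps, each of which moves the points by less
    than e / 2. *)
Lemma locally_cohomologous_segment (e B : R) F G : 0 < e ->
  continuous F -> continuous G ->
  (forall x i, `|G x 0 i - F x 0 i| <= B) ->
  (forall (t : R) x, 0 <= t <= 1 -> sup_norm_ge e ((1 - t) *: F x + t *: G x)) ->
  locally_cohomologous F G.
Proof.
move=> e0 Fc Gc FGB FGfar.
have [N NB] : exists N : nat, 2 * B < N.+1%:R * e.
  exists (Num.truncn (2 * B / e)).
  by rewrite -ltr_pdivrMr//; exact: truncnS_gt.
pose H j x := (1 - j%:R / N.+1%:R) *: F x + (j%:R / N.+1%:R) *: G x.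
have Hc j : continuous (H j).
  apply: mx_continuous => i i'.
  rewrite (_ : (fun x => H j x i i') = fun x =>
    (1 - j%:R / N.+1%:R) * F x i i' + (j%:R / N.+1%:R) * G x i i').
    apply: continuous_add; apply: continuous_mul; try exact: cst_continuous.
      exact: coord_map_continuous.
    exact: coord_map_continuous.
  by apply/funext => x; rewrite !mxE.
have main j : (j <= N.+1)%N -> locally_cohomologous F (H j).
  elim: j => [_|j IH jN].
    rewrite (_ : H 0%N = F); first exact: locally_cohomologous_refl.
    by apply/funext => x; rewrite /H mul0r subr0 scale1r scale0r addr0.
  apply: locally_cohomologous_trans (IH (ltnW jN)) _.
  have t01 i : (i <= N.+1)%N -> 0 <= (i%:R / N.+1%:R : R) <= 1.
    move=> iN; rewrite divr_ge0 ?ler0n//= ler_pdivrMr ?ltr0n// mul1r.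
    by rewrite ler_nat.
  apply: (locally_cohomologous_close e0) => //.
  - by move=> x; apply: FGfar; apply: t01; exact: ltnW.
  - by move=> x; apply: FGfar; exact: t01.
  move=> x i; rewrite !mxE.
  rewrite (_ : _ - _ = (F x 0 i - G x 0 i) / N.+1%:R); last first.
    have : N.+1%:R != 0 :> R by rewrite pnatr_eq0.
    rewrite -[j.+1%:R]natr1; move: (N.+1%:R) => c c0.
    by field.
  rewrite normrM normfV (@ger0_norm _ N.+1%:R)// ltr_pdivrMr ?ltr0n//.
  rewrite distrC (le_lt_trans (FGB x i))//; lra.
have := main N.+1 (leqnn _).
rewrite (_ : H _ = G)//; apply/funext => x.
by rewrite /H divff ?pnatr_eq0// subrr scale0r add0r scale1r.
Qed.

End local_cochains.

(** * Powers of the first Stiefel-Whitney class *)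

Section descent.
Context {R : realType} {X : topologicalType} (g : free_involution X) {k : nat}.
Variables (F0 F1 : X -> 'rV[R]_k.+2) (eps : R).
Hypotheses (eps_gt0 : 0 < eps)
  (F1_continuous : continuous F1) (F1_far : forall x, sup_norm_ge eps (F1 x))
  (F1_odd : forall x, F1 (g x) = - F1 x) (F0_even : forall x, F0 (g x) = F0 x)
  (F0_F1 : locally_cohomologous F0 F1).

Let Y := orbit_space g.
Let S j x : 'F_2 := sgn j (F1 x).

(** Two lifts in fine sets of the same small simplex differ by the involution,
    because F1 takes opposite values on an orbit. On the lifts, psi is a cochain
    whose coboundary represents the power of w_1. *)
Definition fine_set (psi : seq X -> 'F_2) (W : set X) := [/\ open W,
  forall x y, W x -> W y -> sup_close eps (F1 x) (F1 y) &
  forall l, size l = k.+2 -> (forall x, x \in l -> W x) ->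
    face_sum psi l = sign_cup S 0 k.+1 l].

(** If e is a cochain with coboundary F0^* s + F1^* s, where s is axis_cochain,
    let psi be the sum of e and its image under g. In its coboundary, F0^* s
    occurs twice because F0 is even, and what is left is F1^* s + (- F1)^* s,
    the product of the sign changes. *)
Lemma exists_fine_sets : exists2 psi : seq X -> 'F_2,
  (forall l, psi (map g l) = psi l) &
  forall x, exists2 W, fine_set psi W & W x.
Proof.
have [e eP] := F0_F1.
exists (fun l => e l + e (map g l)) => [l|x].
  rewrite -map_comp (eq_map (inv_involutive g)) map_id addrC.
  by [].
have [U xU UP] := eP x; have [V xV VP] := eP (g x).
have e2 : 0 < eps / 2 by rewrite divr_gt0.
pose W := [set y | [/\ U y, V (g y) & sup_close (eps / 2) (F1 y) (F1 x)]].
have xW : nbhs x W.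
  have : nbhs x (U `&` ((g : X -> X) @^-1` V `&`
      [set y | sup_close (eps / 2) (F1 y) (F1 x)])).
    apply: filterI => //; apply: filterI; first exact: inv_continuous.
    exact: sup_close_near.
  by apply: filterS => y [? []].
exists (W^°); last by [].
split; first exact: open_interior.
  move=> y z /interior_subset[_ _ yx] /interior_subset[_ _ zx] i.
  have := yx i; have := zx i; rewrite !ltr_norml => /andP[? ?] /andP[? ?].
  by apply/andP; split; lra.
move=> l lk lW; have {}lW y : y \in l -> W y.
  by move=> /lW/interior_subset.
rewrite face_sumD UP => [||y /lW[]//]; last by [].
rewrite (_ : face_sum (fun l => e (map g l)) l = face_sum e (map g l));
  last by rewrite -face_sum_map.
rewrite VP ?size_map// => [|_ /mapP[y /lW[_ + _] ->]//].
rewrite -!map_comp (eq_map (F0_even : F0 \o g =1 F0)).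
rewrite (eq_map (F1_odd : F1 \o g =1 -%R \o F1)) [map (-%R \o F1) _]map_comp.
rewrite addrACA addFF2 add0r (@axis_cochainN _ _ eps)//.
- rewrite (@sign_cup_map _ _ _ S)//.
- by rewrite size_map.
- move=> _ _ /mapP[y /lW[_ _ yx] ->] /mapP[z /lW[_ _ zx] ->] i.
  have := yx i; have := zx i; rewrite !ltr_norml => /andP[? ?] /andP[? ?].
  by apply/andP; split; lra.
- by move=> _ /mapP[y _ ->].
Qed.

Lemma inv_not_close x : ~ sup_close eps (F1 x) (F1 (g x)).
Proof.
have [i xi] := F1_far x; move=> /(_ i); rewrite F1_odd mxE opprK.
by rewrite -mulr2n normrMn mulr2n; have := normr_ge0 (F1 x 0 i); lra.
Qed.

Lemma inv_separated x : exists W : set X,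
  [/\ open W, W x & forall p, W p -> ~ W (g p)].
Proof.
pose W := [set y | sup_close (eps / 2) (F1 y) (F1 x)].
exists (W^°); split; first exact: open_interior.
  by apply: sup_close_near => //; rewrite divr_gt0.
move=> p /interior_subset px /interior_subset gpx.
apply: (@inv_not_close p) => i; have := px i; have := gpx i.
by rewrite !ltr_norml => /andP[? ?] /andP[? ?]; apply/andP; split; lra.
Qed.

Variable psi : seq X -> 'F_2.

Definition lifts m (s : singular R Y m) (l : seq X) :=
  (exists2 W, fine_set psi W & forall x, x \in l -> W x) /\
  map (orbit g) l = map s (vertices m).

Definition fine_simplex m (s : singular R Y m) :=
  exists2 W, fine_set psi W & range s `<=` orbit g @` W.

Lemma fine_simplex_lifts m (s : singular R Y m) : fine_simplex s ->
  exists l, lifts s l.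
Proof.
move=> [W fW sW].
have sW' v : exists x, W x /\ orbit g x = s v.
  by have [x Wx xE] : (orbit g @` W) (s v) by [apply: sW; exists v]; exists x.
have [l lP] := choice sW'; exists (map l (vertices m)); split.
  by exists W => // _ /mapP[v _ ->]; exact: (lP v).1.
by rewrite -map_comp; apply: eq_map => v; exact: (lP v).2.
Qed.

Lemma lifts_size m (s : singular R Y m) l : lifts s l -> size l = m.+1.
Proof.
by move=> [_ lE]; rewrite -(size_map (orbit g)) lE size_map size_vertices.
Qed.

Lemma map_orbit_eq (l l' : seq X) : map (orbit g) l = map (orbit g) l' ->
  (forall x, x \in l -> g x \in l' -> False) -> l = l'.
Proof.
elim: l l' => [|x l IH] [|x' l']//= [xx' ll'] ng.
rewrite (IH l') => // [|y yl gyl'];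
  last by apply: (ng y); rewrite inE (yl, gyl') orbT.
congr (_ :: _); move/orbitP: xx' => [//|xE].
by case: (ng x); rewrite ?mem_head// xE inv_involutive mem_head.
Qed.

Lemma lifts_unique m (s : singular R Y m) l l' :
  lifts s l -> lifts s l' -> l' = l \/ l' = map g l.
Proof.
move=> [[W [_ Wc _] lW] lE] [[W' [_ Wc' _] lW'] lE'].
case: l lW lE => [|x l] lW lE; case: l' lW' lE' => [|x' l'] lW' lE';
  try by rewrite -lE in lE'.
  by left.
have far y : ~ (forall i, `|F1 y 0 i| < eps).
  by move=> ye; have [i] := F1_far y; rewrite leNgt ye.
move: (lE'); rewrite -lE => -[/orbitP[xx|xx] ll']; [left|right].
  apply: map_orbit_eq; first by rewrite lE.
  move=> y yl' gyl; apply: (far x) => i.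
  have := Wc _ _ (lW _ (mem_head _ _)) (lW _ gyl) i.
  have := Wc' _ _ (lW' _ (mem_head _ _)) (lW' _ yl') i.
  rewrite xx F1_odd mxE !ltr_norml => /andP[? ?] /andP[? ?].
  by apply/andP; split; lra.
apply: map_orbit_eq.
  rewrite lE' -lE -map_comp; apply: eq_map => y.
  by apply/orbitP; right; rewrite /= inv_involutive.
move=> y yl' /mapP[z zl /(can_inj (inv_involutive g)) yz]; apply: (far x) => i.
have := Wc _ _ (lW _ (mem_head _ _)) (lW _ zl) i.
have := Wc' _ _ (lW' _ (mem_head _ _)) (lW' _ yl') i.
rewrite xx yz F1_odd mxE !ltr_norml => /andP[? ?] /andP[? ?].
by apply/andP; split; lra.
Qed.

(** The cochain of the orbit space induced by an invariant cochain phi; by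
    lifts_unique the choice of the list is immaterial. *)
Definition descend (phi : seq X -> 'F_2) m : cochain R Y m := fun s =>
  if pselect (exists l, lifts s l) is left lP then phi (sval (cid lP)) else 0.

Lemma descendE phi m (s : singular R Y m) l :
  (forall t, phi (map g t) = phi t) -> lifts s l -> descend phi s = phi l.
Proof.
move=> phig sl; rewrite /descend; case: pselect => [lP|[]]; last by exists l.
case: cid => l' /= sl'; have [->//|->] := lifts_unique sl sl'.
exact: phig.
Qed.

Lemma lifts_restr m p (th : 'I_m.+1 -> 'I_p.+1) (s : singular R Y p) l l' :
  lifts s l -> {subset l' <= l} ->
  map (orbit g) l' = [seq s (vertex (th i)) | i <- enum 'I_m.+1] ->
  lifts (restr th s) l'.
Proof.
move=> [[W fW lW] _] l'l l'E; split; first by exists W => // x /l'l; exact: lW.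
rewrite l'E.
rewrite -[RHS]map_comp; apply: eq_map => i.
by rewrite /= vertex_map_vertex.
Qed.

Lemma lifts_face m (s : singular R Y m.+1) l (i : 'I_m.+2) : lifts s l ->
  lifts (restr (lift i) s) (delete i l).
Proof.
move=> sl; apply: lifts_restr (sl) _ _; first exact: mem_delete.
rewrite map_delete sl.2 -map_delete -vertices_delete -!map_comp.
by apply: eq_map => j /=; rewrite vertex_map_vertex.
Qed.

Lemma coboundary_descend phi m (s : singular R Y m.+1) l :
  (forall t, phi (map g t) = phi t) -> lifts s l ->
  coboundary (descend phi (m := m)) s = face_sum phi l.
Proof.
move=> phig sl; rewrite face_sumE (lifts_size sl); apply: eq_bigr => i _.
by apply: descendE => //; exact: lifts_face.
Qed.

Lemma fine_simplex_restr m p (th : 'I_m.+1 -> 'I_p.+1) (s : singular R Y p) :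
  fine_simplex s -> fine_simplex (restr th s).
Proof.
move=> [W fW sW]; exists W => // _ [v _ <-].
by apply: sW; exists (vertex_map th v).
Qed.

Lemma coboundaryK m (c : cochain R Y m) : coboundary (coboundary c) = 0.
Proof.
apply/funext => s; rewrite -[LHS]on_affine_vertices -face_sum_on_affine.
by rewrite -face_sum_on_affine face_sumK.
Qed.

Lemma vertices1 :
  vertices 1 = [:: vertex ord0; vertex ord_max] :> seq (simplex R 1).
Proof.
rewrite /vertices !enum_ordSl /= enum_ord0 /=.
by congr [:: _; vertex _]; apply/val_inj.
Qed.

(** The Thom class gives a cocycle b(x) + b(y). Adding the coboundary of the
    invariant function b + S j replaces b by S j. *)
Lemma w1_sign_cocycle w j : is_w1 g w -> exists a : cocycles R Y 1,
  coh_class a = w /\ forall s l, fine_simplex s -> lifts s l ->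
    val a s = sign_cup S j 1 l.
Proof.
move=> [u u_thom ->]; set a := pull_cocycle _ u.
have [b [bg ab]] := thom_pullback inv_separated u_thom.
have bgE x : b (g x) = b x + 1 by rewrite -(bg x) addF2K.
pose phi l := if l is [:: x] then b x + S j x else 0.
have phig l : phi (map g l) = phi l.
  case: l => [|x [|y l]]//=; rewrite bgE /S F1_odd (@sgnN _ _ eps)//.
  by rewrite addrACA addFF2 addr0.
have aP : val a + coboundary (descend phi (m := 0)) \in @cocycle R Y 1.
  have /asboolP a0 := valP a.
  by apply/asboolP; rewrite raddfD /= a0 coboundaryK addr0.
exists (exist _ (val a + coboundary (descend phi (m := 0))) aP); split.
  apply/eqP/coh_classP; exists (descend phi (m := 0)) => /=.
  by rewrite addrC addKr.
move=> s l [W [oW Wc Wpsi] sW] sl.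
rewrite [LHS](_ : _ = val a s + coboundary (descend phi (m := 0)) s)//.
rewrite (coboundary_descend phig sl).
have [t [tc tW ts]] : exists t : simplex R 1 -> X, [/\ continuous t,
    forall v, W (t v) & forall v, orbit g (t v) = s v].
  apply: orbit_lift => //.
  - by move=> p Wp /(Wc _ _ Wp); exact: inv_not_close.
  - exact: cts_fun.
  - by move=> v; apply: sW; exists v.
have tl : lifts s [:: t (vertex ord0); t (vertex ord_max)].
  split; last by rewrite vertices1 /= !ts.
  by exists W => [|x]; [split|rewrite !inE => /orP[]/eqP->; exact: tW].
have -> : val a s = b (t (vertex ord0)) + b (t (vertex ord_max)).
  rewrite -(ab (mkcts tc)); congr (val a _); apply/continuousEP => v.
  by rewrite -ts.
have -> : b (t (vertex ord0)) + b (t (vertex ord_max)) =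
    (if l is [:: x; y] then b x + b y else 0).
  have [->|->] := lifts_unique tl sl => //=.
  by rewrite !bgE addrACA addFF2 addr0.
case: l sl => [|x [|y [|z l]]] sl; have := lifts_size sl => //= _.
rewrite /= addr0 mulr1 -[LHS]addrA.
have F2E (p q r v : 'F_2) : p + (q + (q + v + (p + r))) = r + v.
  by move: (F2_case p) (F2_case q) (F2_case r) (F2_case v)
    => [->|->] [->|->] [->|->] [->|->]; apply: ord_inj.
exact: F2E.
Qed.

Lemma lifts_segments m (s : singular R Y m.+1) x y l : lifts s [:: x, y & l] ->
  lifts (restr (@segment m.+1 0 1) s) [:: x; y] /\
  lifts (restr (@segment m.+1 1 m) s) (y :: l).
Proof.
move=> sl; have [_] := sl; rewrite /vertices !enum_ordSl /= => -[xE yE lE].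
split; apply: lifts_restr (sl) _ _.
- by move=> z; rewrite !inE => /orP[]->; rewrite ?orbT.
- rewrite !enum_ordSl enum_ord0 /= xE yE.
  by congr [:: s (vertex _); s (vertex _)]; apply/val_inj; rewrite /= val_segment.
- by move=> z zl; rewrite inE zl orbT.
have [_] := sl; rewrite /vertices enum_ordSl => -[_ ylE]; apply: (etrans ylE).
rewrite -!map_comp; apply: eq_map => i; congr (s (vertex _)).
by apply/val_inj; rewrite /= val_segment// -ltnS.
Qed.

(** All the factors are represented by different cocycles, one for each
    coordinate; this is why the product is concentrated near the last axis. *)
Lemma cup_power_sign_cocycle w : is_w1 g w -> forall m j,
  exists c : cocycles R Y m, coh_class c = cup_power w m /\
    forall s l, fine_simplex s -> lifts s l -> val c s = sign_cup S j m l.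
Proof.
move=> ww; elim=> [|m IH] j.
  by exists (exist _ (fun=> 1) (@one_cochain_cocycle R Y)).
have [c [cw cE]] := IH j.+1; have [a [aw aE]] := w1_sign_cocycle j ww.
exists (cup_cocycle a c); split; first by rewrite /= -cw -aw cup_coh_class.
move=> s [|x [|y l]] fs sl; have := lifts_size sl => //= _.
have [s1 s2] := lifts_segments sl.
rewrite /cup_cochain (aE _ _ _ s1) ?(cE _ _ _ s2) /= ?mulr1//;
  exact: fine_simplex_restr.
Qed.

End descent.

(** The number k.+1 is one less than the dimension of the target: an odd map
    alone kills the power k.+2, and the homotopy to an even map gains one. *)
Theorem cup_power_w1_eq0 {R : realType} {X : topologicalType}
    (g : free_involution X) {k : nat} (F0 F1 : X -> 'rV[R]_k.+2) (eps : R) :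
  0 < eps -> continuous F1 -> (forall x, sup_norm_ge eps (F1 x)) ->
  (forall x, F1 (g x) = - F1 x) -> (forall x, F0 (g x) = F0 x) ->
  locally_cohomologous F0 F1 ->
  forall w : cohomology R (orbit_space g) 1, is_w1 g w -> cup_power w k.+1 = 0.
Proof.
move=> eps0 F1c F1far F1odd F0even F01 w ww.
have [psi psig psiP] := exists_fine_sets eps0 F1c F1far F1odd F0even F01.
have [c [<- cE]] := cup_power_sign_cocycle eps0 F1c F1far F1odd psi ww k.+1 0.
have [e eE] : exists e : cochain R (orbit_space g) k,
    val c - coboundary (descend (g := g) F1 eps psi psi (m := k)) = coboundary e.
  pose U := [set A | exists2 W, fine_set F1 eps psi W & A = orbit g @` W].
  apply: (@small_cocycle_coboundary R (orbit_space g) k _ U).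
  - by move=> _ [W [oW _ _] ->]; exact: orbit_open.
  - move=> z; have [x <-] := orbit_surj z; have [W fW Wx] := psiP x.
    by exists (orbit g @` W); [exists W|exists x].
  - move=> _ s [W fW ->] sW.
    have fs : fine_simplex F1 eps psi s by exists W.
    have [l sl] := fine_simplex_lifts fs.
    rewrite [LHS](_ : _ = val c s -
      coboundary (descend (g := g) F1 eps psi psi (m := k)) s)//.
    rewrite (cE _ _ fs sl) (coboundary_descend F1far F1odd psig sl).
    have [[W' [_ _ W'E] lW'] _] := sl.
    by rewrite W'E ?subrr ?(lifts_size sl).
  have /asboolP c0 := valP c.
  by rewrite raddfB /= c0 coboundaryK subr0.
have -> : 0 = coh_class (0 : cocycles R (orbit_space g) k.+1).
  apply/esym; exact: (raddf0 (\pi_(cohomology R (orbit_space g) k.+1)%qT)).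
apply/eqP/coh_classP; exists (e + descend (g := g) F1 eps psi psi (m := k)).
by rewrite raddfD /= -eE subrK subr0.
Qed.

(** * Maps from the Hom complex of an odd cycle *)

Section disjoint_points.
Context {R : realType} {k : nat}.
Implicit Types u v : 'rV[R]_k.+3.

Definition disjoint_support u v := forall a, u 0 a = 0 \/ v 0 a = 0.

Lemma disjoint_supportC u v : disjoint_support u v -> disjoint_support v u.
Proof. by move=> uv a; case: (uv a); [right|left]. Qed.

(** One of k.+2 coordinates with sum 1 is at least their mean. *)
Lemma std_simplex_large u : std_simplex R k.+3 u -> u 0 ord_max = 0 ->
  exists i : 'I_k.+2, k.+2%:R^-1 <= u 0 (lift ord_max i).
Proof.
move=> [u0 u1] umax; apply/not_existsP => small.
have : \sum_(i < k.+2) u 0 (lift ord_max i) < \sum_(i < k.+2) k.+2%:R^-1.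
  apply: ltr_sum => [|i _]; first by rewrite /index_enum -enumT /= enum_ordSl.
  by rewrite ltNge; apply/negP/small.
rewrite sumr_const card_ord -[ltRHS]mulr_natl divff ?pnatr_eq0//.
rewrite [X in X < _](_ : _ = 1) ?ltxx// -u1 [RHS]big_ord_recr /= umax addr0.
apply: eq_bigr => i _; congr (u 0 _); apply/val_inj.
exact: lift_max.
Qed.

(** The two points do not both have mass at the last vertex. One that has none
    there has a large coordinate elsewhere, at which the other one vanishes. *)
Lemma disjoint_far u v : std_simplex R k.+3 u -> std_simplex R k.+3 v ->
  disjoint_support u v -> sup_norm_ge k.+2%:R^-1 (col' ord_max (u - v)).
Proof.
move=> su sv uv.
have e0 : 0 < k.+2%:R^-1 :> R by rewrite invr_gt0 ltr0n.
wlog umax : u v su sv uv / u 0 ord_max = 0.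
  move=> wl; case: (uv ord_max) => [|vmax]; first exact: wl.
  have [i vi] := wl v u sv su (disjoint_supportC uv) vmax; exists i.
  by rewrite -normrN; move: vi; rewrite !mxE opprB.
have [i ui] := std_simplex_large su umax; exists i.
rewrite !mxE; case: (uv (lift ord_max i)) => [ui0|->].
  by move: ui; rewrite ui0 leNgt e0.
by rewrite subr0 (le_trans ui)// ler_norm.
Qed.

Lemma std_simplex_convex u v (t : R) : 0 <= t <= 1 -> std_simplex R k.+3 u ->
  std_simplex R k.+3 v -> std_simplex R k.+3 ((1 - t) *: u + t *: v).
Proof.
move=> /andP[t0 t1] [u0 u1] [v0 v1]; split=> [i|].
  by rewrite !mxE addr_ge0// mulr_ge0// subr_ge0.
under eq_bigr do rewrite !mxE.
by rewrite big_split /= -!mulr_sumr u1 v1 !mulr1 subrK.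
Qed.

Lemma std_simplex_le1 u i : std_simplex R k.+3 u -> 0 <= u 0 i <= 1.
Proof.
move=> [u0 u1]; rewrite u0 -u1 (bigD1 i)//= lerDl.
by apply: sumr_ge0.
Qed.

End disjoint_points.

Section differences.
Context {R : realType} {X : topologicalType} {k : nat}.
Implicit Types (c : R) (u v : X -> 'rV[R]_k.+3).

Definition difference (c : R) (u v : X -> 'rV[R]_k.+3) (x : X) : 'rV[R]_k.+2 :=
  c *: col' ord_max (u x - v x).

Lemma difference_far c u v : `|c| = 1 ->
  (forall x, std_simplex R k.+3 (u x)) -> (forall x, std_simplex R k.+3 (v x)) ->
  (forall x, disjoint_support (u x) (v x)) ->
  forall x, sup_norm_ge k.+2%:R^-1 (difference c u v x).
Proof.
move=> c1 su sv uv x; have [i xi] := disjoint_far (su x) (sv x) (uv x).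
by exists i; rewrite mxE normrM c1 mul1r.
Qed.

Lemma difference_continuous c u v : continuous u -> continuous v ->
  continuous (difference c u v).
Proof.
move=> uc vc; apply: mx_continuous => i j.
rewrite (_ : (fun x => _) =
  fun x => c * (u x i (lift ord_max j) - v x i (lift ord_max j))); last first.
  by apply/funext => x; rewrite !mxE.
apply: continuous_mul; first exact: cst_continuous.
apply: continuous_add; last apply: continuous_opp;
  exact: coord_map_continuous.
Qed.

Lemma difference_cohomologous c u u' v v' : `|c| = 1 ->
  continuous u -> continuous u' -> continuous v -> continuous v' ->
  (forall x, [/\ std_simplex R k.+3 (u x), std_simplex R k.+3 (u' x),
                 std_simplex R k.+3 (v x) & std_simplex R k.+3 (v' x)]) ->
  (forall x, [/\ disjoint_support (u x) (v x),
                 disjoint_support (u x) (v' x),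
                 disjoint_support (u' x) (v x) &
                 disjoint_support (u' x) (v' x)]) ->
  locally_cohomologous (difference c u v) (difference c u' v').
Proof.
move=> c1 uc u'c vc v'c ss dd.
apply: (@locally_cohomologous_segment _ _ _ (k.+2%:R^-1) 2).
- by rewrite invr_gt0 ltr0n.
- exact: difference_continuous.
- exact: difference_continuous.
- move=> x i; rewrite !mxE -mulrBr normrM c1 mul1r.
  have [su su' sv sv'] := ss x.
  have := std_simplex_le1 (lift ord_max i) su.
  have := std_simplex_le1 (lift ord_max i) su'.
  have := std_simplex_le1 (lift ord_max i) sv.
  have := std_simplex_le1 (lift ord_max i) sv'.
  by rewrite ler_norml; lra.
move=> t x t01.
have := @difference_far c (fun x => (1 - t) *: u x + t *: u' x)
  (fun x => (1 - t) *: v x + t *: v' x) c1 _ _ _ x.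
rewrite (_ : difference _ _ _ _ =
  (1 - t) *: difference c u v x + t *: difference c u' v' x); last first.
  by apply/rowP => i; rewrite !mxE; ring.
apply => y; [| |]; have [su su' sv sv'] := ss y.
- exact: std_simplex_convex.
- exact: std_simplex_convex.
move=> a; have [/(_ a) d1 /(_ a) d2 /(_ a) d3 /(_ a) d4] := dd y.
rewrite !mxE.
have [u0|u0] := eqVneq (u y 0 a) 0; have [u'0|u'0] := eqVneq (u' y 0 a) 0.
- by left; rewrite u0 u'0 !mulr0 addr0.
- by right; case: d3 d4 u'0 => [->|->]; rewrite ?eqxx// => -[->|->];
    rewrite ?eqxx// !mulr0 addr0.
- by right; case: d1 d2 u0 => [->|->]; rewrite ?eqxx// => -[->|->];
    rewrite ?eqxx// !mulr0 addr0.
- by right; case: d1 d2 u0 => [->|->]; rewrite ?eqxx// => -[->|->];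
    rewrite ?eqxx// !mulr0 addr0.
Qed.

End differences.

Section cycle.
Context {R : realType} {r k : nat}.
Let X := cycle_complex R r k.+3.

Definition vertex_row (v : 'Z_(r.*2.+1)) (p : X) : 'rV[R]_k.+3 := row v (val p).

Lemma vertex_row_simplex v p : std_simplex R k.+3 (vertex_row v p).
Proof.
have [sigma _ psigma] := set_mem (valP p).
exact: (psigma v).1.
Qed.

Lemma vertex_row_disjoint v p :
  disjoint_support (vertex_row v p) (vertex_row (v + 1) p).
Proof.
have [sigma [_ sigmaE] psigma] := set_mem (valP p).
move=> a; rewrite !mxE.
have [|pv] := eqVneq (val p v a) 0; first by left.
have [|pw] := eqVneq (val p (v + 1) a) 0; first by right.
have := sigmaE v (v + 1) _ a a ((psigma v).2 a pv) ((psigma (v + 1)).2 a pw).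
by rewrite /odd_cycle eqxx /complete_graph eqxx => /(_ isT).
Qed.

Lemma vertex_row_continuous v : continuous (vertex_row v).
Proof.
apply: mx_continuous => i j.
rewrite (_ : (fun x => _) = (fun q : 'M[R]__ => q v j) \o (val : X -> 'M[R]__)).
  move=> p; apply: continuous_comp; first exact: set_val_continuous.
  exact: coord_continuous.
by apply/funext => p; rewrite /= mxE.
Qed.

Lemma vertex_row_flip v (p : X) : vertex_row v (flip_fun p) = vertex_row (- v) p.
Proof. by apply/rowP => a; rewrite !mxE. Qed.

Definition edge_difference j : X -> 'rV[R]_k.+2 :=
  difference ((-1) ^+ j) (vertex_row j%:R) (vertex_row j.+1%:R).

Definition star_center_difference : X -> 'rV[R]_k.+2 :=
  difference 1 (vertex_row 0)
    (fun p => (1 - 2^-1) *: vertex_row 1 p + 2^-1 *: vertex_row (- 1) p).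

Lemma star_edge_cohomologous :
  locally_cohomologous star_center_difference (edge_difference 0).
Proof.
have half : 0 <= (2^-1 : R) <= 1 by lra.
have d1 p : disjoint_support (vertex_row 0 p) (vertex_row 1 p).
  by have := vertex_row_disjoint 0 p; rewrite add0r.
have dN1 p : disjoint_support (vertex_row 0 p) (vertex_row (- 1) p).
  by apply: disjoint_supportC; have := vertex_row_disjoint (- 1) p; rewrite addNr.
have dh p : disjoint_support (vertex_row 0 p)
    ((1 - 2^-1) *: vertex_row 1 p + 2^-1 *: vertex_row (- 1) p).
  move=> a; case: (d1 p a) => [|a1]; first by left.
  case: (dN1 p a) => [|aN1]; first by left.
  by right; rewrite !mxE in a1 aN1 *; rewrite a1 aN1 !mulr0 addr0.
apply: difference_cohomologous.
- by rewrite normr1.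
- exact: vertex_row_continuous.
- exact: vertex_row_continuous.
- apply: mx_continuous => i j.
  rewrite (_ : (fun p => _) = fun p => (1 - 2^-1) * vertex_row 1 p i j +
    2^-1 * vertex_row (- 1) p i j); last by apply/funext => p; rewrite !mxE.
  apply: continuous_add; apply: continuous_mul; try exact: cst_continuous;
    apply: coord_map_continuous; exact: vertex_row_continuous.
- exact: vertex_row_continuous.
- move=> p; split; try exact: vertex_row_simplex.
  by apply: std_simplex_convex => //; exact: vertex_row_simplex.
- by move=> p; split.
Qed.

(** The sign makes both maps have the term of vertex j.+1 in common, so that
    only the other end of the edge moves, from j to j.+2; both of these are
    neighbours of j.+1. *)
Lemma edge_cohomologous j :
  locally_cohomologous (edge_difference j) (edge_difference j.+1).
Proof.
rewrite (_ : edge_difference j.+1 =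
    difference ((-1) ^+ j) (vertex_row j.+2%:R) (vertex_row j.+1%:R)); last first.
  apply/funext => p; rewrite /edge_difference /difference exprS mulN1r.
  by rewrite scaleNr -scalerN -linearN opprB.
have d p i : disjoint_support (vertex_row i%:R p) (vertex_row i.+1%:R p).
  by have := vertex_row_disjoint i%:R p; rewrite natr1.
apply: difference_cohomologous; try exact: vertex_row_continuous.
- by rewrite normrX normrN normr1 expr1n.
- by move=> p; split; exact: vertex_row_simplex.
- move=> p; split; try exact: d; apply: disjoint_supportC; exact: d.
Qed.

Lemma star_edges_cohomologous j :
  locally_cohomologous star_center_difference (edge_difference j).
Proof.
elim: j => [|j IH]; first exact: star_edge_cohomologous.
exact: locally_cohomologous_trans IH (edge_cohomologous j).
Qed.

Lemma star_center_difference_even p :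
  star_center_difference (flip_fun p) = star_center_difference p.
Proof.
rewrite /star_center_difference /difference !vertex_row_flip oppr0 opprK.
rewrite (_ : _ *: vertex_row (- 1) p + _ = (1 - 2^-1) *: vertex_row 1 p +
  2^-1 *: vertex_row (- 1) p)//.
by apply/rowP => a; rewrite !mxE; lra.
Qed.

Lemma edge_difference_odd p (r_ge1 : (1 <= r)%N) :
  edge_difference r (flip_fun p) = - edge_difference r p.
Proof.
have rE : - r%:R = r.+1%:R :> 'Z_(r.*2.+1).
  apply/esym/eqP; rewrite -addr_eq0 -natrD addSn addnn.
  by rewrite pchar_Zp//; lia.
rewrite /edge_difference /difference !vertex_row_flip.
have -> : - r.+1%:R = r%:R :> 'Z_(r.*2.+1) by rewrite -rE opprK.
rewrite rE.
by rewrite -[in LHS]opprB linearN scalerN.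
Qed.

End cycle.

Theorem theorem1p2 (R : realType) (r n : nat) (r_ge1 : (1 <= r)%N)
    (n_ge3 : (3 <= n)%N)
    (w1 : cohomology R (orbit_space (flip R n r_ge1)) 1) :
  is_w1 (flip R n r_ge1) w1 -> cup_power w1 (n - 2) = 0%R.
Proof.
case: n n_ge3 w1 => [|[|[|k]]]// _ w1; rewrite [(_ - _)%N]/=.
apply: (@cup_power_w1_eq0 R _ _ k star_center_difference (edge_difference r)
  (k.+2%:R^-1)).
- by rewrite invr_gt0 ltr0n.
- by apply: difference_continuous; exact: vertex_row_continuous.
- apply: difference_far => [|p|p|p]; try exact: vertex_row_simplex.
    by rewrite normrX normrN normr1 expr1n.
  by have := vertex_row_disjoint r%:R p; rewrite natr1.
- by move=> p; exact: edge_difference_odd.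
- exact: star_center_difference_even.
- exact: star_edges_cohomologous.
Qed.
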